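(* For every $n\ge1$, the homology of the pointed partition poset $\Pi_P(n)$ with coefficients in $k$ is the $\mathbb{S}_n$-module $$H_l(\Pi_P(n))\cong\begin{cases}\mathcal{P}relie(n)^*\otimes\mathrm{sgn}_{\mathbb{S}_n}&\text{if } l=n-1,\\ 0&\text{otherwise.}\end{cases}$$
   Context: $k$ denotes $\mathbb{Z}$, $\mathbb{Q}$, $\mathbb{F}_p$ or a field of characteristic $0$. A pointed partition of $[n]$ is a set partition of $[n]$ in which exactly one element of each block is emphasized. In $\Pi_P(n)$, $\lambda\le\mu$ iff $\mu$ refines $\lambda$ as a partition and every pointed element of $\lambda$ is pointed in $\mu$; its maximal element is $\{\{\bar1\},\dots,\{\bar n\}\}$ and its minimal elements are the one-block pointed partitions; $\mathbb{S}_n$ acts by relabelling. $H_l(\Pi)$ is the homology of the complex spanned by chains $\lambda_0<\cdots<\lambda_l$ with $\lambda_0$ minimal and $\lambda_l$ maximal, differential $\sum_{0<i<l}(-1)^id_i$, $d_i$ omitting $\lambda_i$. $\mathcal{P}relie$ is the operad of PreLie algebras: one binary operation $\circ$ with $(x\circ y)\circ z-x\circ(y\circ z)=(x\circ z)\circ y-x\circ(z\circ y)$; $\mathcal{P}relie(n)$ is its arity-$n$ component (multilinear operations in $n$ variables), a right $\mathbb{S}_n$-module; $\mathrm{sgn}_{\mathbb{S}_n}$ is the sign representation. *)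

(* Defs.v *)
From HB Require Import structures.
From mathcomp Require Import all_boot all_order all_fingroup all_algebra.
Set Implicit Arguments. Unset Strict Implicit. Unset Printing Implicit Defensive.
Import GRing.Theory.
Local Open Scope ring_scope.

(* A (raw) candidate is a pair (P, S): P a set of blocks, S the set of  *)
(* pointed (emphasized) elements.  It is a pointed partition when P is  *)
(* a set partition of 'I_n and each block contains exactly one element  *)
(* of S.                                                               *)
Definition PP (n : nat) : finType := ({set {set 'I_n}} * {set 'I_n})%type.

Definition pointed_partition n (x : PP n) : bool :=
  partition x.1 [set: 'I_n] &&
  [forall B in x.1, #|B :&: x.2| == 1%N] && (x.2 \subset cover x.1).

Definition pp_le n (lam mu : PP n) : bool :=
  [forall B' in mu.1, [exists B in lam.1, B' \subset B]] && (lam.2 \subset mu.2).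

Definition pp_lt n (lam mu : PP n) : bool := (lam != mu) && pp_le lam mu.

Definition pp_minimal n (lam : PP n) : bool :=
  pointed_partition lam &&
  [forall mu : PP n, pointed_partition mu ==> ~~ pp_lt mu lam].

Definition pp_maximal n (lam : PP n) : bool :=
  pointed_partition lam &&
  [forall mu : PP n, pointed_partition mu ==> ~~ pp_lt lam mu].

Definition pp_act n (s : 'S_n) (x : PP n) : PP n :=
  ([set [set s i | i in B] | B : {set 'I_n} in x.1], [set s i | i in x.2]).

Definition is_chain n (g : seq (PP n)) : bool :=
  all (@pointed_partition n) g && sorted (@pp_lt n) g &&
  (if g is x :: s then pp_minimal x && pp_maximal (last x s) else false).

(* Chain complex: C_l = free k-module on chains of length l (l+1 elts),*)
(* an element is a coefficient function on (l+1)-tuples supported on   *)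
(* chains.                                                             *)
Definition Cspace (k : nzRingType) n (l : nat) := {ffun (l.+1).-tuple (PP n) -> k}.

Definition supported (k : nzRingType) n l (c : Cspace k n l) : Prop :=
  forall g : (l.+1).-tuple (PP n), ~~ is_chain g -> c g = 0.

Definition drop_at (T : Type) (i : nat) (s : seq T) := take i s ++ drop i.+1 s.

(* differential  sum_{0<i<l} (-1)^i d_i  : C_l -> C_{l-1}, on coefficients *)
Definition bd (k : nzRingType) n (l : nat) (c : {ffun (l.+1).-tuple (PP n) -> k})
  : {ffun l.-tuple (PP n) -> k} :=
  [ffun t : l.-tuple (PP n) =>
     \sum_(g : (l.+1).-tuple (PP n))
       \sum_(i < l.+1 | (0 < i)%N && (i < l)%N)
          ((-1) ^+ i * c g) *+ (val t == drop_at i (val g))].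

Definition is_cycle (k : nzRingType) n l (c : Cspace k n l) : Prop :=
  supported c /\ forall t, bd c t = 0.

Definition is_boundary (k : nzRingType) n l (c : Cspace k n l) : Prop :=
  exists y : Cspace k n l.+1, supported y /\ forall g, c g = bd y g.

Definition C_act (k : nzRingType) n l (s : 'S_n) (c : Cspace k n l) : Cspace k n l :=
  [ffun g : (l.+1).-tuple (PP n) => c (map_tuple (pp_act s^-1) g)].

(* The operad PreLie: Prelie(n) = F(n)/R(n) where F(n) is the free     *)
(* k-module on planar binary trees whose leaves are labelled bijectively*)
(* by 'I_n (multilinear monomials of the free magma, Node a b = a o b), *)
(* and R(n) is spanned by the insertions in a context C of the relation *)
(*   (a o b) o c - a o (b o c) - (a o c) o b + a o (c o b).             *)
(* Its dual Prelie(n)^* = Hom(F(n)/R(n), k) is the annihilator of R(n)  *)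
(* among functionals on F(n), which we represent as functions on trees  *)
(* vanishing on non-multilinear trees.                                  *)
Inductive ptree (n : nat) : Type :=
| Leaf of 'I_n
| Node of ptree n & ptree n.

Arguments Leaf {n}.
Arguments Node {n}.

Fixpoint leaves n (t : ptree n) : seq 'I_n :=
  match t with Leaf i => [:: i] | Node a b => leaves a ++ leaves b end.

Definition multilinear n (t : ptree n) : bool := perm_eq (leaves t) (enum 'I_n).

Inductive pctx (n : nat) : Type :=
| Hole
| CtxL of pctx n & ptree n
| CtxR of ptree n & pctx n.

Arguments Hole {n}.

Fixpoint plug n (C : pctx n) (t : ptree n) : ptree n :=
  match C with
  | Hole => t
  | CtxL C' b => Node (plug C' t) b
  | CtxR a C' => Node a (plug C' t)
  end.

Fixpoint relabel n (s : 'S_n) (t : ptree n) : ptree n :=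
  match t with Leaf i => Leaf (s i) | Node a b => Node (relabel s a) (relabel s b) end.

Definition in_prelie_dual (k : nzRingType) n (phi : ptree n -> k) : Prop :=
  (forall t, ~~ multilinear t -> phi t = 0) /\
  (forall (C : pctx n) (a b c : ptree n),
      phi (plug C (Node (Node a b) c)) - phi (plug C (Node a (Node b c)))
    - phi (plug C (Node (Node a c) b)) + phi (plug C (Node a (Node c b))) = 0).

Definition dual_act (k : nzRingType) n (s : 'S_n) (phi : ptree n -> k) : ptree n -> k :=
  fun t => phi (relabel s^-1 t).

(* H_l(Pi_P(n)) = Z_l / B_l  ~=  Prelie(n)^* (x) sgn  as S_n-modules:   *)
(* there is a k-linear S_n-equivariant map f from the cycles onto       *)
(* Prelie(n)^* (with action twisted by the sign) whose kernel is B_l.    *)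
Definition homology_iso_prelie_sgn (k : comNzRingType) n l : Prop :=
  exists f : Cspace k n l -> (ptree n -> k),
    [/\ (forall (a : k) (x y : Cspace k n l), is_cycle x -> is_cycle y ->
           forall t, f [ffun g => a * x g + y g] t = a * f x t + f y t),
        (forall x, is_cycle x -> in_prelie_dual (f x)),
        (forall phi, in_prelie_dual phi ->
           exists2 x, is_cycle x & forall t, f x t = phi t),
        (forall x, is_cycle x -> ((forall t, f x t = 0) <-> is_boundary x)) &
        (forall (s : 'S_n) x, is_cycle x ->
           forall t, f (C_act s x) t = (-1) ^+ odd_perm s * dual_act s (f x) t)].

Definition homology_vanishes (k : comNzRingType) n l : Prop :=
  forall x : Cspace k n l, is_cycle x -> is_boundary x.

Definition pointed_partition_homology (k : comNzRingType) (n : nat) : Prop :=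
  forall l : nat,
    (l = n.-1 -> homology_iso_prelie_sgn k n l) /\
    (l <> n.-1 -> homology_vanishes k n l).

(* Main.v *)
From HB Require Import structures.
Require Import Defs.
From mathcomp Require Import all_boot all_order all_fingroup all_algebra.
Set Implicit Arguments. Unset Strict Implicit. Unset Printing Implicit Defensive.
Import GRing.Theory.
Local Open Scope ring_scope.

(* Pointed partitions of [n] are the idempotent self-maps of [n] (send i to the
   point of its block), and refinement is the natural order of idempotents: f is
   finer than g when f g = g f = g.  Ordered from the identity upwards, every
   interval is semimodular: two distinct mergings of x below z have a common
   merging below z.  Vanishing below the top degree follows by a Mayer-Vietoris
   induction on the atoms: chains whose first element lies above an atom a form a
   cone, and those that also lie above an earlier atom are, by semimodularity, the
   chains of [a, -] above a family of atoms of that interval.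

   A maximal chain is a word of n - 1 moves "p is absorbed by q".  Two consecutive
   moves on disjoint points can be exchanged, and three blocks merge into one with
   point a in exactly four ways.  Once twisted by the sign of the order in which
   points disappear, the cycle equations say that a function of words is invariant
   under exchanges and satisfies the pre-Lie relation.  A planar tree gives a word
   by reading its nodes in postorder, a word rebuilds a tree, and this identifies
   top cycles with functionals on trees killed by the pre-Lie relators; relabelling
   by s multiplies the twist by the sign of s. *)

(** * Chain complexes of semimodular posets *)

Section Boundary.
Variables (k : nzRingType) (T : finType).
Implicit Types (c e : seq T -> k) (s : seq T).

(** The differential on coefficient functions: sum over all ways to insert one element before some
    entry, never at the end. Lists leave the bottom element of a chain implicit, so both ends stay
    fixed and only interior elements are deleted. *)
Fixpoint chain_bd c s : k :=
  if s is w :: s' then \sum_z c (z :: s) - chain_bd (fun u => c (w :: u)) s' else 0.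

Lemma eq_chain_bd c e : c =1 e -> chain_bd c =1 chain_bd e.
Proof.
move=> eqce s; elim: s c e eqce => [|w s IH] c e eqce //=.
by rewrite (IH _ (fun u => e (w :: u))) // (eq_bigr (fun z => e [:: z, w & s])).
Qed.

Lemma chain_bd_add c e s : chain_bd (fun u => c u + e u) s = chain_bd c s + chain_bd e s.
Proof.
elim: s c e => [|w s IH] c e /=; first by rewrite addr0.
by rewrite IH big_split /= opprD addrACA.
Qed.

Lemma chain_bd_opp c s : chain_bd (fun u => - c u) s = - chain_bd c s.
Proof.
elim: s c => [|w s IH] c /=; first by rewrite oppr0.
by rewrite IH sumrN opprB opprK addrC.
Qed.

Lemma chain_bd_0 s : chain_bd (fun=> 0) s = 0.
Proof. by elim: s => //= w s ->; rewrite big1 ?subr0. Qed.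

Lemma chain_bd_sum (I : finType) (F : I -> seq T -> k) s :
  chain_bd (fun u => \sum_i F i u) s = \sum_i chain_bd (F i) s.
Proof.
elim: s F => [|w s IH] F /=; first by rewrite big1.
by rewrite IH sumrB exchange_big.
Qed.

Lemma chain_bd_comp c s : chain_bd (chain_bd c) s = 0.
Proof.
elim: s c => [|w s IH] c //=.
rewrite chain_bd_add chain_bd_sum chain_bd_opp IH oppr0 addr0 big_split /= sumrN.
rewrite sumrB [X in _ - (X - _)]exchange_big /= subKr.
by rewrite subrr.
Qed.

Lemma chain_bd_expand c s :
  chain_bd c s = \sum_(i < size s) (-1) ^+ i * \sum_z c (take i s ++ z :: drop i s).
Proof.
elim: s c => [|w s IH] c /=; first by rewrite big_ord0.
rewrite big_ord_recl /= expr0 mul1r IH -sumrN; congr (_ + _).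
by apply: eq_bigr => i _; rewrite exprS mulN1r mulNr.
Qed.

Lemma chain_bd_neq0 c s : chain_bd c s != 0 ->
  exists i z, (i < size s)%N /\ c (take i s ++ z :: drop i s) != 0.
Proof.
move=> Dc; suff /existsP[i /existsP[z cz]] :
    [exists i : 'I_(size s), exists z, c (take i s ++ z :: drop i s) != 0].
  by exists i, z; split.
apply: contraNT Dc; rewrite negb_exists => /forallP H.
rewrite chain_bd_expand big1 // => i _; rewrite big1 ?mulr0 // => z _.
by move: (H i); rewrite negb_exists => /forallP/(_ z); rewrite negbK => /eqP.
Qed.

End Boundary.

(** * Acyclicity below the top degree in a graded semimodular poset *)

Section Acyclicity.
Variables (k : nzRingType) (T : finType) (lt : rel T) (rk : T -> nat) (R : nat).
Hypotheses (lt_trans : transitive lt) (rk_lt : forall x y, lt x y -> (rk x < rk y)%N).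

Let le x y := (x == y) || lt x y.
Definition covers x y := lt x y && (rk y == (rk x).+1).

Hypothesis semimod : forall x a a' z, a != a' -> covers x a -> covers x a' ->
  le a z -> le a' z -> exists b, [/\ covers a b, lt a' b & le b z].

Definition starts_above (A : seq T) (s : seq T) :=
  if s is z :: _ then has (fun a => le a z) A else false.

(** Since [x] is not an entry of [s], the same list can be read as a chain from [x] or from an atom
    below its first entry; this lets the induction change base points. *)
Definition chain_from x l (s : seq T) :=
  [&& size s == l, path lt x s & rk (last x s) == R].

Definition supp_above x A l (c : seq T -> k) :=
  forall s, c s != 0 -> chain_from x l s && starts_above A s.

Let lt_le x y z : lt x y -> le y z -> lt x z.
Proof. by move=> xy /orP[/eqP<-//|]; apply: lt_trans. Qed.

Let le_lt x y z : le x y -> lt y z -> lt x z.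
Proof. by move=> /orP[/eqP->//|]; apply: lt_trans. Qed.

Let le_trans' x y z : le x y -> le y z -> le x z.
Proof. by move=> xy /orP[/eqP<-//|yz]; rewrite /le (le_lt xy yz) orbT. Qed.

Let lt_irr x : lt x x = false.
Proof. by apply/negP => /rk_lt; rewrite ltnn. Qed.

Lemma path_delete x s i z :
  path lt x (take i s ++ z :: drop i s) -> path lt x s.
Proof.
move=> H; have/(subseq_path lt_trans): subseq s (take i s ++ z :: drop i s).
  by rewrite -{1}(cat_take_drop i s) cat_subseq ?subseq_cons.
exact.
Qed.

Lemma last_insert x (s : seq T) i z : (i < size s)%N ->
  last x (take i s ++ z :: drop i s) = last x s.
Proof.
move=> lis; rewrite -{3}(cat_take_drop i s) !last_cat /=.
by case: (drop i s) (size_drop i s) => //= /esym/eqP; rewrite subn_eq0 leqNgt lis.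
Qed.

Lemma size_insert (s : seq T) i z : size (take i s ++ z :: drop i s) = (size s).+1.
Proof. by rewrite size_cat /= addnS -size_cat cat_take_drop. Qed.

Lemma chain_delete x l s i z : (i < size s)%N ->
  chain_from x l (take i s ++ z :: drop i s) -> (0 < l)%N && chain_from x l.-1 s.
Proof.
move=> lis /and3P[/eqP<- /path_delete Hp]; rewrite last_insert // size_insert => Hr.
by rewrite /chain_from /= eqxx Hp.
Qed.

Lemma starts_above_delete x A s i z : (i < size s)%N ->
  path lt x (take i s ++ z :: drop i s) ->
  starts_above A (take i s ++ z :: drop i s) -> starts_above A s.
Proof.
case: s i => [|w s] [|i] //= _ /and3P[_ zw _] /hasP[a aA az].
by apply/hasP; exists a => //; rewrite /le (le_lt az zw) orbT.
Qed.

Lemma supp_chain_bd x A l c : supp_above x A l c -> supp_above x A l.-1 (chain_bd c).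
Proof.
move=> Hc s /chain_bd_neq0[i [z [lis /Hc /andP[Hch Hst]]]].
have /andP[_ ->] := chain_delete lis Hch.
have /and3P[_ Hp _] := Hch.
exact: starts_above_delete lis Hp Hst.
Qed.

(** Prefixing [a] is a contracting homotopy of the cone with apex [a]. The rank bound excludes the
    one-element chain at [a], the only place where the homotopy would fail. *)
Lemma cone_acyclic x a l c : covers x a -> (l + rk x < R)%N ->
  supp_above x [:: a] l c -> (forall s, chain_bd c s = 0) ->
  exists2 e, supp_above x [:: a] l.+1 e & forall s, chain_bd e s = c s.
Proof.
move=> xa lR Hc Dc.
(* Values at chains already starting at [a] are discarded, because prefixing would repeat [a]; the
   cycle equation recovers them at the end. *)
pose c' (u : seq T) := if u is v :: _ then if v == a then 0 else c u else 0.
have c'E v u : v != a -> c' (v :: u) = c (v :: u) by rewrite /c' => /negbTE->.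
pose e (u : seq T) := if u is v :: u' then if v == a then c' u' else 0 else 0.
exists e.
  move=> [|v [|w u]] /=; [by rewrite eqxx|by rewrite if_same eqxx|].
  case: (eqVneq v a) => [->|]; last by rewrite eqxx.
  case: (eqVneq w a) => [->|wa]; first by rewrite eqxx.
  move=> /Hc /andP[/and3P[sz /= /andP[xw Hp] Hl]]; rewrite orbF => aw.
  rewrite /chain_from /= in sz *; rewrite eqSS sz Hp Hl.
  have [/andP[-> _] ->] : covers x a /\ le a a by rewrite /le eqxx.
  by move: aw; rewrite /le eq_sym (negbTE wa) /= => ->.
move=> [|w s] /=; first by apply/esym/eqP; apply/negP => /negP /Hc; rewrite andbF.
have [wa|wa] := eqVneq w a; last first.
  rewrite chain_bd_0 subr0 (bigD1 a) //= eqxx big1 ?addr0 ?c'E //.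
  by move=> z za; rewrite (negbTE za).
rewrite wa big1 ?sub0r; last by move=> z _; rewrite if_same.
case: s => [|v s] /=.
  rewrite oppr0; apply/esym/eqP; apply/negP => /negP /Hc /andP[/and3P[/= /eqP l1 _ /eqP rR] _].
  by case/andP: xa => _ /eqP rxa; move: lR; rewrite -l1 -rR rxa add1n ltnn.
have [->|va] := eqVneq v a.
  rewrite chain_bd_0 subr0 big1 ?oppr0.
    apply/esym/eqP; apply/negP => /negP /Hc /andP[/and3P[_ /= /and3P[_]]].
    by rewrite lt_irr.
  move=> z _; case: eqP => // /eqP za; apply/eqP; apply/negP => /negP /Hc.
  rewrite /= orbF => /andP[/and3P[_ /= /and3P[_ za' _] _] az].
  by move: (le_lt az za'); rewrite lt_irr.
(* The cycle equation at [v :: s] expresses the value at [a :: v :: s] through the insertions that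
   [c'] keeps. *)
have := Dc (v :: s); rewrite /= (bigD1 a) //= [in X in _ -> X = _](bigD1 a) //= eqxx add0r.
rewrite -addrA => /eqP; rewrite addr_eq0 => /eqP ->; congr (- (_ - _)).
by apply: eq_bigr => z /negbTE ->.
Qed.

(** Outer induction on the corank [R - rk x], inner induction on the list of atoms. The intersection
    of the cone at [a] with the chains above the other atoms is treated above [a] in one degree
    less; the rank bound survives because [rk a] is one more than [rk x]. *)
Theorem semimodular_acyclic x A l c : (forall a, a \in A -> covers x a) ->
  (l + rk x < R)%N -> supp_above x A l c -> (forall s, chain_bd c s = 0) ->
  exists2 e, supp_above x A l.+1 e & forall s, chain_bd e s = c s.
Proof.
move: {2}(R - rk x)%N (leqnn (R - rk x)) => d.
elim: d x A l c => [|d IHd] x A l c.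
  by rewrite leqn0 subn_eq0 => Rx _ lR; move: (leq_ltn_trans (leq_addl _ _) lR); rewrite ltnNge Rx.
move=> Rd; elim: A c => [|a A IHA] c HA lR Hc Dc.
  have c0 s : c s = 0.
    apply/eqP; apply/negP => /negP /Hc; case: s => [|z s]; by rewrite andbF.
  by exists (fun=> 0) => [s|s]; rewrite ?eqxx // chain_bd_0 c0.
have HA' b : b \in A -> covers x b by move=> bA; apply: HA; rewrite inE bA orbT.
have xa : covers x a by apply: HA; rewrite mem_head.
have subA s : starts_above A s -> starts_above (a :: A) s.
  by case: s => //= z s ->; rewrite orbT.
have [aA|aA] := boolP (a \in A).
  have [|e He De] := IHA c HA' lR _ Dc.
    move=> s /Hc /andP[->]; case: s => //= z s /orP[az|//].
    by apply/hasP; exists a.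
  by exists e => // s /He /andP[-> /subA ->].
(* As [c] is a cycle, its two parts have opposite boundaries, which therefore live on chains above
   both [a] and an atom of [A]. *)
pose c1 s := if starts_above A s then c s else 0.
pose c2 s := if starts_above A s then 0 else c s.
have c12 s : c s = c1 s + c2 s.
  by rewrite /c1 /c2; case: ifP; rewrite ?addr0 ?add0r.
have Hc1 : supp_above x A l c1.
  by move=> s; rewrite /c1; case: ifP; rewrite ?eqxx // => _ /Hc /andP[->].
have Hc2 : supp_above x [:: a] l c2.
  move=> s; rewrite /c2; case: ifP; rewrite ?eqxx // => nA /Hc /andP[->].
  by case: s nA => //= z s ->; rewrite !orbF.
have Dc12 s : chain_bd c2 s = - chain_bd c1 s.
  by apply/eqP; rewrite -addr_eq0 addrC -chain_bd_add -(eq_chain_bd c12) Dc.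
(* By semimodularity, a chain above [a] and some other atom in [A] starts above one of these covers
   of [a]. *)
pose A' := [seq b <- enum T | covers a b & has (fun a' => le a' b) A].
have Hb : supp_above a A' l.-1 (chain_bd c2).
  move=> s ns; have /andP[/and3P[sz Hp Hl] Ha] := supp_chain_bd Hc2 ns.
  have /andP[_ HAs] : chain_from x l.-1 s && starts_above A s.
    by apply: (supp_chain_bd Hc1); move: ns; rewrite Dc12 oppr_eq0.
  case: s {ns} sz Hp Hl Ha HAs => //= z s sz /andP[xz Hp] Hl; rewrite orbF => az.
  case/hasP=> a' a'A a'z.
  have aa' : a != a' by apply: contraNneq aA => ->.
  have [b [ab a'b bz]] := semimod aa' xa (HA' _ a'A) az a'z.
  have az' : lt a z by apply: lt_le bz; case/andP: ab.
  rewrite /chain_from /= sz az' Hp Hl /=; apply/hasP; exists b => //.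
  rewrite mem_filter ab mem_enum !andbT; apply/hasP; exists a' => //.
  by rewrite /le a'b orbT.
have [l0|l0] := posnP l.
  exists (fun=> 0) => s; rewrite ?eqxx // chain_bd_0; apply/esym/eqP; apply/negP => /negP /Hc.
  by rewrite l0 => /andP[/and3P[/nilP -> ]].
have [rka xa'] : rk a = (rk x).+1 /\ lt x a by case/andP: xa => ? /eqP.
have [||||b0 Hb0 Db0] := IHd a A' l.-1 (chain_bd c2) _ _ _ Hb.
- by rewrite rka subnS -ltnS prednK // subn_gt0 (leq_ltn_trans (leq_addl _ _) lR).
- by move=> b; rewrite mem_filter => /andP[/andP[]].
- by rewrite rka addnS -addSn prednK.
- by move=> s; rewrite chain_bd_comp.
(* [b0] has the boundary of [c2] and lies above both [a] and [A], so [c2 - b0] is a cycle of the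
   cone at [a] and [c1 + b0] a cycle above [A]. *)
have Hb1 s : b0 s != 0 -> [/\ chain_from x l s, starts_above A s & starts_above [:: a] s].
  move=> /Hb0; rewrite prednK // => /andP[/and3P[sz Hp Hl]].
  case: s sz Hp Hl => //= z s sz /andP[az Hp] Hl /hasP[b]; rewrite mem_filter.
  move=> /andP[/andP[ab /hasP[a' a'A a'b]] _] bz; split.
  - by rewrite /chain_from /= sz Hl Hp (lt_trans xa' az).
  - by apply/hasP; exists a' => //; apply: le_trans' bz.
  by rewrite /le az orbT.
have [|s|e2 He2 De2] := @cone_acyclic x a l (fun s => c2 s - b0 s) xa lR.
- move=> s; have [b0s|/Hb1[-> _ ->]//] := eqVneq (b0 s) 0.
  by rewrite b0s subr0 => /Hc2.
- by rewrite chain_bd_add chain_bd_opp Db0 subrr.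
have [|s|e1 He1 De1] := IHA (fun s => c1 s + b0 s) HA' lR.
- move=> s; have [b0s|/Hb1[-> ->]//] := eqVneq (b0 s) 0.
  by rewrite b0s addr0 => /Hc1.
- by rewrite chain_bd_add Db0 Dc12 subrr.
exists (fun s => e1 s + e2 s) => s; last first.
  by rewrite chain_bd_add De1 De2 c12 addrACA subrr addr0.
have [->|/He1 /andP[-> /subA ->]//] := eqVneq (e1 s) 0.
rewrite add0r => /He2 /andP[->]; case: s => //= z s.
by rewrite orbF => ->.
Qed.

End Acyclicity.

(** * Pointed partitions as idempotent maps *)

Section Idempotents.
Variable n : nat.
Local Notation pmap := {ffun 'I_n -> 'I_n}.
Implicit Types (x y z a b : pmap) (i j p q : 'I_n).

Definition idem x := [forall i, x (x i) == x i].

(** Read as: [y] is coarser than [x]. The first equation puts the fibres of [x] inside those of [y],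
    the second makes every point of [y] a point of [x]. The identity is the least element. *)
Definition coarser x y :=
  [&& idem x, idem y & [forall i, (y (x i) == y i) && (x (y i) == y i)]].

Definition scoarser x y := (x != y) && coarser x y.

(** On idempotents this is [n] minus the number of blocks. *)
Definition rk x := #|[pred i | x i != i]|.

Definition absorb p q x : pmap := [ffun i => if x i == p then q else x i].

Definition fid : pmap := [ffun i => i].

Lemma idemP x : reflect (forall i, x (x i) = x i) (idem x).
Proof. exact: 'forall_eqP. Qed.

Lemma idem_fid : idem fid.
Proof. by apply/idemP => i; rewrite !ffunE. Qed.

Lemma coarserP x y :
  reflect [/\ idem x, idem y, forall i, y (x i) = y i & forall i, x (y i) = y i]
          (coarser x y).
Proof.
apply: (iffP and3P) => [[-> -> /forallP H]|[-> -> H1 H2]].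
  by split=> // i; case/andP: (H i) => /eqP ? /eqP.
by split=> //; apply/forallP => i; rewrite H1 H2 !eqxx.
Qed.

Lemma coarser_refl x : idem x -> coarser x x.
Proof. by move=> ix; apply/coarserP; split=> // i; apply/idemP. Qed.

Lemma le_coarser x y : idem x -> (x == y) || scoarser x y = coarser x y.
Proof.
by rewrite /scoarser; case: eqP => //= <- /coarser_refl ->.
Qed.

Lemma coarser_trans : transitive coarser.
Proof.
move=> y x z /coarserP[ix iy yx xy] /coarserP[_ iz zy yz].
apply/coarserP; split=> // i; first by rewrite -zy yx zy.
by rewrite -yz xy.
Qed.

Lemma coarser_fix x y i : coarser x y -> y i = i -> x i = i.
Proof. by case/coarserP => _ _ _ xy yi; rewrite -yi xy. Qed.

Lemma rk_coarser x y : coarser x y -> (rk x <= rk y)%N.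
Proof.
move=> xy; apply/subset_leq_card/subsetP => i; rewrite !inE.
by apply: contraNneq => yi; apply/eqP; apply: coarser_fix yi.
Qed.

(** Equal ranks force equal sets of points, and [y i = y (x i)], where [x i] is a point of [x],
    hence of [y]. *)
Lemma coarser_rk_eq x y : coarser x y -> rk x = rk y -> x = y.
Proof.
move=> xy rxy; have [ix iy yx _] := coarserP _ _ xy.
have sub : [pred i | x i != i] \subset [pred i | y i != i].
  apply/subsetP => i; rewrite !inE.
  by apply: contraNneq => yi; apply/eqP; apply: coarser_fix yi.
have /subset_cardP/(_ sub) E := rxy.
apply/ffunP => i; rewrite -[y i]yx; apply/eqP; rewrite eq_sym; apply/negP => /negP H.
by have := E (x i); rewrite !inE (idemP _ ix) eqxx H.
Qed.

Lemma rk_scoarser x y : scoarser x y -> (rk x < rk y)%N.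
Proof.
case/andP => nxy xy; rewrite ltn_neqAle rk_coarser // andbT.
by apply: contraNneq nxy => /(coarser_rk_eq xy) ->.
Qed.

Lemma scoarser_trans : transitive scoarser.
Proof.
move=> y x z xy yz; rewrite /scoarser; apply/andP; split.
  apply/eqP => exz; have := ltn_trans (rk_scoarser xy) (rk_scoarser yz).
  by rewrite exz ltnn.
by case/andP: xy => _; case/andP: yz => _ yz /coarser_trans; apply.
Qed.

Local Notation cov := (covers scoarser rk).

Lemma rk_fid : rk fid = 0%N.
Proof. by apply: eq_card0 => i; rewrite !inE ffunE eqxx. Qed.

Lemma absorbE p q x i : absorb p q x i = if x i == p then q else x i.
Proof. by rewrite ffunE. Qed.

Lemma cov_absorb x p q : idem x -> x p = p -> x q = q -> p != q ->
  cov x (absorb p q x).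
Proof.
move=> /idemP ix xp xq pq.
have xy : coarser x (absorb p q x).
  apply/coarserP; split=> [||i|i]; [exact/idemP| |by rewrite !absorbE ix|].
    apply/idemP => i; rewrite !absorbE; case: (eqVneq (x i) p) => [|xip].
      by rewrite xq eq_sym (negbTE pq).
    by rewrite ix (negbTE xip).
  by rewrite !absorbE; case: eqP => // _; rewrite ix.
have rxy : rk (absorb p q x) = (rk x).+1.
  rewrite /rk (cardD1 p) inE absorbE xp eqxx eq_sym pq add1n; congr _.+1.
  apply: eq_card => i; rewrite !inE absorbE; case: (eqVneq i p) => [->|ip] /=.
    by rewrite xp eqxx.
  case: (eqVneq (x i) p) => // xip.
  rewrite xip [p == i]eq_sym ip.
  by apply: contraNneq pq => qi; rewrite -xip -qi xq.
rewrite /covers /scoarser xy rxy eqxx !andbT.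
by apply/eqP => exy; move: rxy; rewrite -exy => /n_Sn.
Qed.

(** One step of rank loses exactly one point [p], and [y] is then determined by where it sends
    [p]. *)
Lemma covP x y : cov x y ->
  exists p q, [/\ x p = p, x q = q, p != q & y = absorb p q x].
Proof.
case/andP => /andP[nxy xy] /eqP rxy; have [/idemP ix /idemP iy yx xy'] := coarserP _ _ xy.
have [p /andP[/eqP xp yp]] : exists p, (x p == p) && (y p != p).
  apply/existsP; apply: contraNT nxy; rewrite negb_exists => /forallP H.
  apply/eqP/ffunP => i; move: (H (x i)).
  by rewrite ix eqxx /= negbK yx => /eqP.
have uniqp i : x i = i -> y i != i -> i = p.
  move=> xi yi; apply/eqP; apply: contraT => ip.
  have : ((rk x).+2 <= rk y)%N.
    rewrite /rk [leqRHS](cardD1 p) [X in (_ + X)%N](cardD1 i) !inE /= yp yi ip !add1n !ltnS.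
    apply/subset_leq_card/subsetP => j; rewrite !inE => xj.
    have -> : y j != j by apply: contraNneq xj => yj; apply/eqP; apply: coarser_fix yj.
    by rewrite andbT; apply/andP; split; apply: contraNneq xj => ->; apply/eqP.
  by rewrite rxy ltnn.
exists p, (y p); split; rewrite // 1?eq_sym //; apply/ffunP => i; rewrite absorbE.
case: (eqVneq (x i) p) => [<-|xip]; first by rewrite yx.
by apply/eqP; apply: contraNT xip; rewrite -(yx i) => /uniqp -> //.
Qed.

Lemma absorb_coarser p q x z : coarser x z -> x p = p -> x q = q -> p != q ->
  z p = z q -> z p != p -> coarser (absorb p q x) z.
Proof.
move=> xz xp xq pq zpq zp.
have [ix iz zx xz'] := coarserP _ _ xz.
have /andP[/andP[_ /coarserP[_ im _ _]] _] := cov_absorb ix xp xq pq.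
apply/coarserP; split=> // i; rewrite absorbE.
  by case: (eqVneq (x i) p) => [xip|]; rewrite ?zx // -zpq -xip zx.
rewrite xz'; case: (eqVneq (z i) p) => // zip.
by move: zp; rewrite -{1}zip (idemP _ iz) zip eqxx.
Qed.

(** A point of [x] that [z] has lost can be absorbed by its image under [z]. *)
Lemma exists_cov x z : scoarser x z -> exists2 a, cov x a & coarser a z.
Proof.
case/andP => nxz xz; have [ix iz zx xz'] := coarserP _ _ xz.
have [p /andP[/eqP xp zp]] : exists p, (x p == p) && (z p != p).
  apply/existsP; apply: contraNT nxz; rewrite negb_exists => /forallP H.
  apply/eqP/ffunP => i; move: (H (x i)).
  by rewrite (idemP _ ix) eqxx /= negbK zx => /eqP.
exists (absorb p (z p) x); first by apply: cov_absorb; rewrite // eq_sym.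
by apply: absorb_coarser; rewrite ?(idemP _ iz) // eq_sym.
Qed.

(** On top of [a], the blocks merged by [a'] are merged in the direction that [z] permits. Only when
    [a] and [a'] merge the same two blocks in opposite directions is a third block needed. *)
Lemma coarser_semimodular x a a' z : a != a' -> cov x a -> cov x a' ->
  coarser a z -> coarser a' z ->
  exists b, [/\ cov a b, scoarser a' b & coarser b z].
Proof.
move=> naa' xa xa' az a'z.
suff [b ab [a'b bz]] : exists2 b, cov a b & coarser a' b /\ coarser b z.
  exists b; split=> //; rewrite /scoarser a'b andbT; apply/eqP => ea'b.
  by case/andP: xa' xa ab => _ /eqP + /andP[_ /eqP +] /andP[_ /eqP];
     rewrite ea'b => -> -> /n_Sn.
have [p [q [xp xq pq ea]]] := covP xa; have [p' [q' [xp' xq' pq' ea']]] := covP xa'.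
have /andP[/andP[_ cxa] _] := xa; have /andP[/andP[_ cxa'] _] := xa'.
have [ix ia ax xa_] := coarserP _ _ cxa; have [_ ia' a'x xa'_] := coarserP _ _ cxa'.
have [_ iz za az'] := coarserP _ _ az; have [_ _ za' az''] := coarserP _ _ a'z.
have ap : a p = q by rewrite ea absorbE xp eqxx.
have aq : a q = q by rewrite -ap (idemP _ ia).
have a'p' : a' p' = q' by rewrite ea' absorbE xp' eqxx.
have afix i : x i = i -> i != p -> a i = i.
  by move=> xi /negbTE ip; rewrite ea absorbE xi ip.
have zp' : z p' != p'.
  apply/eqP => zp'; have := az'' p'; rewrite zp' a'p' => e.
  by rewrite e eqxx in pq'.
have zpq' : z p' = z q' by rewrite -a'p' za'.
(* One more move u -> v inside a block of z yields b; it also dominates a' as soon as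
   it joins p' to q' and p' is no longer a point. *)
have glue u v : a u = u -> a v = v -> u != v -> z u = z v -> z u != u ->
    (absorb u v a p' = absorb u v a q') -> absorb u v a p' != p' ->
    exists2 b, cov a b & coarser a' b /\ coarser b z.
  move=> au av uv zuv zu bp'q' bp'; have ab := cov_absorb ia au av uv.
  exists (absorb u v a) => //; split; last by apply: absorb_coarser.
  have xb : coarser x (absorb u v a).
    by apply: coarser_trans cxa _; case/andP: ab => /andP[].
  by rewrite ea'; apply: absorb_coarser.
(* If [a] already joins [p'] and [q'], then [a'] is the reverse move, and [z] points the common
   block at a third element, which absorbs [q]. *)
have [eapq|napq] := eqVneq (a p') (a q').
  have [ep'|np'] := eqVneq p' p.
    have eq : q' = q.
      by rewrite -ap -ep' eapq afix // eq_sym -ep'.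
    by move: naa'; rewrite ea ea' ep' eq eqxx.
  have eq' : q' = p.
    apply/eqP; apply: contraT => nq'; move: eapq; rewrite !afix // => e.
    by rewrite e eqxx in pq'.
  have ep' : p' = q by move: eapq; rewrite afix // eq' ap.
  apply: (glue q (z p)); rewrite ?az' ?(idemP _ iz) //.
  - by rewrite -ep' eq_sym -eq' -zpq'.
  - by rewrite -ap za.
  - by rewrite -ep'.
  - by rewrite !absorbE eapq.
  by rewrite absorbE ep' aq eqxx -ep' -eq' -zpq'.
have aa i : a (a i) = a i by apply/idemP.
(* Otherwise the two blocks are still distinct in [a]; the one absorbed must have a point that [z]
   does not keep. *)
have [zap|zap] := eqVneq (z (a p')) (a p').
  have np' : p' != a p' by apply: contraNneq zp' => e; rewrite e zap.
  have zq : z (a q') != a q'.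
    by rewrite za -zpq' -(za p') zap.
  apply: (glue (a q') (a p')); rewrite ?aa ?za // 1?eq_sym //.
  - by rewrite za in zq; rewrite eq_sym.
  - by rewrite !absorbE eqxx (negbTE napq).
  by rewrite absorbE (negbTE napq).
apply: (glue (a p') (a q')); rewrite ?aa ?za //.
- by rewrite za in zap.
- by rewrite !absorbE eqxx eq_sym (negbTE napq).
(* [p'] could remain a point only if [a q' = p'], which would again make [a'] the reverse of [a]. *)
rewrite absorbE eqxx; apply/eqP => aqp'.
have := xa_ q'; rewrite aqp' => _.
have: p' = q' \/ p' = q /\ q' = p.
  move: aqp'; rewrite ea absorbE xq'; case: eqP => [-> ->|_ ->]; by [right|left].
case=> [e|[e1 e2]]; first by rewrite e eqxx in pq'.
by move: napq; rewrite e1 e2 ap aq eqxx.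
Qed.

End Idempotents.

(** * Top cycles and words of moves *)

Section ListSign.
Variable n : nat.
Implicit Types (l : seq 'I_n) (s : 'S_n).

(* The n - 1 entries of [l] determine the last entry of the permutation. *)
Definition list_sign l : bool :=
  [exists s : 'S_n, odd_perm s && (take n.-1 [seq s i | i <- enum 'I_n] == l)].

(** The quotient of the two permutations fixes every index except possibly the last, hence the last
    as well. *)
Lemma take_perm_inj s s' :
  take n.-1 [seq s i | i <- enum 'I_n] = take n.-1 [seq s' i | i <- enum 'I_n] -> s = s'.
Proof.
move=> E; have fixt (i : 'I_n) : (i < n.-1)%N -> s i = s' i.
  move=> ltin; have := congr1 (fun l => nth i l i) E.
  by rewrite !nth_take // !(nth_map i) -?enumT ?size_enum_ord ?nth_ord_enum. 
apply/permP => i; have [/fixt//|lein] := ltnP i n.-1.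
pose t := (s * s'^-1)%g; suff: t i = i by move/(congr1 s'); rewrite permM permKV.
apply/eqP; apply: contraT => ti; have [ltj|tn] := ltnP (t i) n.-1.
  have tt : t (t i) = t i by rewrite {1}/t permM fixt // permK.
  by rewrite (perm_inj tt) eqxx in ti.
case/eqP: ti; apply/val_inj => /=.
have lt_max (j : 'I_n) : (n.-1 <= j)%N -> j = n.-1 :> nat.
  by move=> lej; apply/eqP; rewrite eqn_leq lej -ltnS (ltn_predK (ltn_ord j)) ltn_ord.
by rewrite (lt_max _ lein) (lt_max _ tn).
Qed.

Lemma list_sign_take s : list_sign (take n.-1 [seq s i | i <- enum 'I_n]) = odd_perm s.
Proof.
apply/existsP/idP => [[s' /andP[os' /eqP/take_perm_inj <-//]]|os].
by exists s; rewrite os eqxx.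
Qed.

Lemma take_perm_exists l : uniq l -> size l = n.-1 ->
  exists s, l = take n.-1 [seq s i | i <- enum 'I_n].
Proof.
case: n l => [|m] l Ul szl.
  by exists 1%g; move/eqP/nilP: szl => ->; rewrite take0.
(* A list of [m] distinct points misses some [r]; appending it lists all values of a permutation. *)
have [r rl] : exists r, r \notin l.
  apply/existsP; apply: contraPT szl; rewrite negb_exists => /forallP H.
  suff : (m.+1 <= size l)%N by move=> lem /= E; rewrite E ltnn in lem.
  rewrite -{1}(card_ord m.+1) -(card_uniqP Ul) subset_leq_card //.
  by apply/subsetP => i _; move: (H i); rewrite negbK.
have szr : size (rcons l r) = m.+1 by rewrite size_rcons szl.
have inj : injective (fun i : 'I_m.+1 => nth r (rcons l r) i).
  move=> i j /eqP; rewrite nth_uniq ?szr ?rcons_uniq ?rl //.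
  by move/eqP/val_inj.
exists (perm inj); apply: (@eq_from_nth _ r).
  by rewrite size_take size_map size_enum_ord ltnS leqnn szl.
move=> i; rewrite szl /= => lti; have lti' : (i < m.+1)%N by rewrite ltnW.
rewrite nth_take // (nth_map r) ?size_enum_ord // permE nth_enum_ord //.
by rewrite nth_rcons szl lti.
Qed.

(** The sign representation enters here: relabelling composes the permutation extending [l] with
    [s]. *)
Lemma list_sign_map s l : uniq l -> size l = n.-1 ->
  list_sign [seq s i | i <- l] = odd_perm s (+) list_sign l.
Proof.
move=> Ul /(take_perm_exists Ul)[s0 ->].
rewrite list_sign_take map_take -map_comp addbC -odd_permM -list_sign_take.
by congr (list_sign (take _ _)); apply: eq_map => i /=; rewrite permM.
Qed.

(** Exchanging two entries is relabelling by their transposition, which fixes all the others. *)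
Lemma list_sign_swap l1 l2 p q : uniq (l1 ++ p :: q :: l2) ->
  size (l1 ++ p :: q :: l2) = n.-1 ->
  list_sign (l1 ++ q :: p :: l2) = ~~ list_sign (l1 ++ p :: q :: l2).
Proof.
move=> Ul szl; have pq : p != q.
  by move: Ul; rewrite cat_uniq /= inE !negb_or -!andbA => /and5P[_ _ _ _ /andP[]].
have <- : odd_perm (tperm p q) (+) list_sign (l1 ++ p :: q :: l2) =
          ~~ list_sign (l1 ++ p :: q :: l2) by rewrite odd_tperm pq.
rewrite -list_sign_map // map_cat /= tpermL tpermR.
have fixl l : p \notin l -> q \notin l -> [seq tperm p q i | i <- l] = l.
  move=> pl ql; rewrite -{2}(map_id l); apply/eq_in_map => i il.
  by rewrite tpermD //; [apply: contraNneq pl|apply: contraNneq ql] => ->.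
move: Ul; rewrite cat_uniq /= inE !negb_or -!andbA => /and5P[_ pl1 ql1 _ /and4P[_ pl2 ql2 _]].
by rewrite !fixl.
Qed.

End ListSign.

(** * Words of moves and the chains they trace *)

Section Words.
Variable n : nat.
Local Notation pmap := {ffun 'I_n -> 'I_n}.
Local Notation cov := (covers (@scoarser n) (@rk n)).
Local Notation word := (seq ('I_n * 'I_n)).
Implicit Types (x y z : pmap) (p q : 'I_n) (w : word) (s : seq pmap).

Definition wend x w := foldl (fun x m => absorb m.1 m.2 x) x w.

Fixpoint wchain x w : seq pmap :=
  if w is m :: w' then let y := absorb m.1 m.2 x in y :: wchain y w' else [::].

Fixpoint valid x w :=
  if w is m :: w' then
    [&& x m.1 == m.1, x m.2 == m.2, m.1 != m.2 & valid (absorb m.1 m.2 x) w']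
  else true.

Definition complete w := valid (fid n) w && (size w == n.-1).

Definition maxchain s := path cov (fid n) s && (size s == n.-1).

Lemma wchain_cat x w1 w2 : wchain x (w1 ++ w2) = wchain x w1 ++ wchain (wend x w1) w2.
Proof. by elim: w1 x => //= m w IH x; rewrite IH. Qed.

Lemma valid_cat x w1 w2 : valid x (w1 ++ w2) = valid x w1 && valid (wend x w1) w2.
Proof. by elim: w1 x => //= m w IH x; rewrite IH !andbA. Qed.

Lemma size_wchain x w : size (wchain x w) = size w.
Proof. by elim: w x => //= m w IH x; rewrite IH. Qed.

Lemma last_wchain x w : last x (wchain x w) = wend x w.
Proof. by elim: w x => //= m w IH x; rewrite IH. Qed.

Lemma idem_absorb x p q : idem x -> x p = p -> x q = q -> p != q -> idem (absorb p q x).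
Proof.
by move=> ix xp xq pq; case/andP: (cov_absorb ix xp xq pq) => /andP[_ /and3P[]].
Qed.

Lemma path_wchain x w : idem x -> valid x w -> path cov x (wchain x w).
Proof.
elim: w x => //= m w IH x ix /and4P[/eqP x1 /eqP x2 m12 vw].
by rewrite cov_absorb //= IH // idem_absorb.
Qed.

Lemma maxchain_wchain w : complete w -> maxchain (wchain (fid n) w).
Proof.
by case/andP=> vw sw; rewrite /maxchain size_wchain sw path_wchain // idem_fid.
Qed.

Lemma absorb_fix x p q i : x q = q -> p != q -> absorb p q x i = i -> x i = i /\ x i != p.
Proof.
rewrite absorbE => xq pq; case: eqVneq => // xip qi; move: pq.
by rewrite -xip -qi xq eqxx.
Qed.

(** An absorbed point never becomes a point again; this provides the hypotheses of the [list_sign]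
    lemmas for complete words. *)
Lemma valid_uniq x w : valid x w ->
  uniq [seq m.1 | m <- w] /\ {in [seq m.1 | m <- w], forall p, x p = p}.
Proof.
elim: w x => //= m w IH x /and4P[/eqP x1 /eqP x2 m12 /IH[-> H]]; split.
  rewrite andbT; apply/negP => /H/(absorb_fix x2 m12)[_].
  by rewrite x1 eqxx.
by move=> p; rewrite inE => /predU1P[->//|/H/(absorb_fix x2 m12)[]].
Qed.

Lemma cov_idem x y : cov x y -> idem x /\ idem y.
Proof. by case/andP => /andP[_ /and3P[]]. Qed.

Lemma path_cov_word x s : path cov x s -> exists2 w, valid x w & wchain x w = s.
Proof.
elim: s x => [|y s IH] x /=; first by exists [::].
case/andP => /covP[p [q [xp xq pq ->]]] /IH[w vw <-].
by exists ((p, q) :: w); rewrite //= xp xq pq !eqxx.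
Qed.

(** Inverse of [wchain] on valid words: a cover loses a single point, and the image of that point
    names the absorber. *)
Fixpoint moves_of x s : word :=
  if s is y :: s' then
    if [pick p | (x p == p) && (y p != p)] is Some p then (p, y p) :: moves_of y s'
    else [::]
  else [::].

Lemma wchainK x w : valid x w -> moves_of x (wchain x w) = w.
Proof.
elim: w x => //= -[p q] w IH x /= /and4P[/eqP xp /eqP xq pq vw].
case: pickP => [r /andP[/eqP xr]|/(_ p)]; last first.
  by rewrite absorbE xp !eqxx eq_sym (negbTE pq).
rewrite absorbE xr; case: (eqVneq r p) => [-> _|]; last by rewrite eqxx.
by rewrite IH.
Qed.

(** Neither move may consume a point that the other one uses, but the absorbers [q] and [q'] may
    coincide. *)
Lemma absorbC x p q p' q' : p != p' -> p != q' -> p' != q ->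
  absorb p' q' (absorb p q x) = absorb p q (absorb p' q' x).
Proof.
move=> pp' pq' p'q; apply/ffunP => i; rewrite !absorbE.
case: (eqVneq (x i) p) => [->|xip].
  by rewrite (negbTE pp') eqxx eq_sym (negbTE p'q).
by case: (eqVneq (x i) p') => _; rewrite ?[q' == _]eq_sym ?(negbTE pq') ?(negbTE xip).
Qed.

Lemma absorb_chain x a b c : a != b -> a != c -> b != c ->
  absorb b a (absorb c b x) = absorb c a (absorb b a x).
Proof.
move=> ab ac bc; apply/ffunP => i; rewrite !absorbE.
case: (eqVneq (x i) c) => [->|xic].
  by rewrite [c == b]eq_sym (negbTE bc) !eqxx.
by case: (eqVneq (x i) b) => xib; rewrite ?(negbTE ac) ?(negbTE xic).
Qed.

Lemma between_absorb x z y u v : x u = u -> x v = v -> u != v -> z = absorb u v x ->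
  cov z y -> y u = y v /\ y u != u.
Proof.
move=> xu xv uv -> /andP[/andP[_ /coarserP[_ _ yz zy]] _]; split.
  by rewrite -(yz u) absorbE xu eqxx.
apply: contraNneq uv => yu; have := zy u; rewrite yu absorbE xu eqxx => <-.
exact: eqxx.
Qed.

(** * Intervals of length two and the cycle equations on words *)

Section Sums.
Variable k : nzRingType.

(** The interval is a square: an intermediate element absorbs [u] into [v], both in one block of
    [y], with [u] not a point of [y]; only the two given moves qualify. *)
Lemma sum_disjoint (F : pmap -> k) x p q p' q' : let y := absorb p' q' (absorb p q x) in
  x p = p -> x q = q -> x p' = p' -> x q' = q' ->
  p != q -> p' != q' -> p != p' -> p != q' -> q != p' -> q != q' ->
  (forall z, F z != 0 -> cov x z && cov z y) ->
  \sum_z F z = F (absorb p q x) + F (absorb p' q' x).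
Proof.
move=> y xp xq xp' xq' pq p'q' pp' pq' qp' qq' HF.
rewrite (bigD1 (absorb p q x)) //= (bigD1 (absorb p' q' x)) /=; last first.
  apply/eqP => /ffunP/(_ p); rewrite !absorbE xp eqxx (negbTE pp') => pq1.
  by rewrite pq1 eqxx in pq.
rewrite big1 ?addr0 // => z /andP[zn1 zn2]; apply/eqP; apply: contraT.
case/HF/andP => /covP[u [v [xu xv uv ez]]] /(between_absorb xu xv uv ez)[yuv yu].
have yE i : x i = i -> y i = if i == p then q else if i == p' then q' else i.
  move=> xi; rewrite !absorbE xi; case: (eqVneq i p) => // _.
  by rewrite (negbTE qp').
move: yuv yu; rewrite !yE //.
case: (eqVneq u p) => [eu|up].
  rewrite eu in ez uv; case: (eqVneq v p) uv => [//|_ _].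
  case: (eqVneq v p') => [_ e|_ e]; first by rewrite e eqxx in qq'.
  by rewrite ez e eqxx in zn1.
case: (eqVneq u p') => [eu|]; last by rewrite eqxx.
rewrite eu in ez uv; case: (eqVneq v p) => [_ e|_].
  by rewrite e eqxx in qq'.
case: (eqVneq v p') uv => [//|_ _ e].
by rewrite ez e eqxx in zn2.
Qed.

(** The three blocks end with point [a], so the first move absorbs [b] or [c] into one of the other
    two points: four intermediates. *)
Lemma sum_triple (F : pmap -> k) x a b c : let y := absorb c a (absorb b a x) in
  x a = a -> x b = b -> x c = c -> a != b -> a != c -> b != c ->
  (forall z, F z != 0 -> cov x z && cov z y) ->
  \sum_z F z = F (absorb b a x) + F (absorb c a x) + F (absorb c b x) + F (absorb b c x).
Proof.
move=> y xa xb xc ab ac bc HF.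
have ba : (b == a) = false by rewrite eq_sym (negbTE ab).
have ca : (c == a) = false by rewrite eq_sym (negbTE ac).
have cb : (c == b) = false by rewrite eq_sym (negbTE bc).
have neq (z z' : pmap) i : z i != z' i -> z != z' by apply: contraNneq => ->.
pose vals := (xa, xb, xc, ba, ca, cb, negbTE ab, negbTE ac, negbTE bc, eqxx).
rewrite (bigD1 (absorb b a x)) //= (bigD1 (absorb c a x)) /=; last first.
  by apply: (neq _ _ b); rewrite !absorbE !vals.
rewrite (bigD1 (absorb c b x)) /=; last first.
  by apply/andP; split; apply: (neq _ _ c); rewrite !absorbE !vals.
rewrite (bigD1 (absorb b c x)) /=; last first.
  by rewrite -andbA; apply/and3P; split; apply: (neq _ _ b); rewrite !absorbE !vals.
rewrite big1 ?addr0 ?addrA // => z /andP[/andP[/andP[z1 z2] z3] z4].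
apply/eqP; apply: contraT.
case/HF/andP => /covP[u [v [xu xv uv ez]]] /(between_absorb xu xv uv ez)[yuv yu].
have yE i : x i = i -> y i = if i == b then a else if i == c then a else i.
  by move=> xi; rewrite !absorbE xi; case: (eqVneq i b) => // _; rewrite !vals.
move: yuv yu uv; rewrite !yE //.
case: (eqVneq u b) => [eu|ub]; [|case: (eqVneq u c) => [eu|uc]; last by rewrite eqxx].
  rewrite eu in ez *; case: (eqVneq v b) => [//|_].
  case: (eqVneq v c) => [ev|_ ev]; first by rewrite ez ev eqxx in z4.
  by rewrite ez ev eqxx in z1.
rewrite eu in ez *; case: (eqVneq v b) => [ev|_]; first by rewrite ez ev eqxx in z3.
case: (eqVneq v c) => [//|_ ev].
by rewrite ez ev eqxx in z2.
Qed.

(** One equation for each gap in a maximal chain. The entry [y] after the gap keeps the last element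
    from being the one that varies. *)
Definition local_cycle (C : seq pmap -> k) :=
  forall pre y suf, \sum_z C (pre ++ z :: y :: suf) = 0.

Lemma rk_nth x s i : path cov x s -> (i < size s)%N -> rk (nth x s i) = (rk x + i.+1)%N.
Proof.
elim: s x i => //= y s IH x [|i] /andP[/andP[_ /eqP rxy] Hp].
  by rewrite rxy addn1.
rewrite ltnS => lis; rewrite (set_nth_default y) // (IH y) // rxy.
by rewrite addSnnS.
Qed.

(** The ranks along a maximal chain with one element removed show where the gap is, so at most one
    position contributes to the boundary. *)
Lemma chain_bd_local_cycle (C : seq pmap -> k) : (forall s, C s != 0 -> maxchain s) ->
  (forall s, chain_bd C s = 0) -> local_cycle C.
Proof.
move=> HC DC pre y suf; set s := pre ++ y :: suf; set i := size pre.
have lis : (i < size s)%N by rewrite size_cat /= addnS ltnS leq_addr.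
have E z : pre ++ z :: y :: suf = take i s ++ z :: drop i s.
  by rewrite take_size_cat // drop_size_cat.
have := DC s; rewrite chain_bd_expand (bigD1 (Ordinal lis)) //=.
under eq_bigr => z _ do rewrite -E.
set S := \sum_(z : pmap) _; have [->//|S0] := eqVneq S 0.
have [z0 Cz0] : exists z, C (pre ++ z :: y :: suf) != 0.
  apply/existsP; apply: contraNT S0; rewrite negb_exists => /forallP H.
  by rewrite /S big1 // => z _; apply/eqP; move: (H z); rewrite negbK.
(* Insertion at [j] shifts the entry at [j] to rank [j + 2] and leaves an earlier entry [i'] at rank
   [i' + 1]; two different insertion positions would contradict each other. *)
have rk_lt j z : (j < size s)%N -> maxchain (take j s ++ z :: drop j s) ->
    rk (nth (fid n) s j) = j.+2.
  move=> ljs /andP[Hp _].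
  have := @rk_nth _ _ j.+1 Hp; rewrite rk_fid add0n nth_cat size_take ljs.
  rewrite [(j.+1 < j)%N]ltnNge leqnSn subSnn /= nth_drop addn0; apply.
  by rewrite size_insert ltnS.
have rk_gt j i' z : (i' < j)%N -> (j < size s)%N -> maxchain (take j s ++ z :: drop j s) ->
    rk (nth (fid n) s i') = i'.+1.
  move=> lij ljs /andP[Hp _].
  have := @rk_nth _ _ i' Hp; rewrite rk_fid add0n nth_cat size_take ljs lij.
  rewrite nth_take //; apply.
  by rewrite size_insert ltnS ltnW // (ltn_trans lij).
rewrite big1 ?addr0; first by move/eqP; rewrite -signr_odd mulr_sign; case: odd; rewrite ?oppr_eq0 => /eqP.
move=> j nji; rewrite big1 ?mulr0 // => z _; apply/eqP; apply: contraT => /HC Hz.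
move: Cz0; rewrite E => /HC Hz0.
have [lij|lji|eij] := ltngtP i j; last by rewrite -val_eqE /= eij eqxx in nji.
  have := rk_gt _ _ _ lij (ltn_ord j) Hz.
  by rewrite (rk_lt _ _ lis Hz0) => /esym/n_Sn.
have := rk_gt _ _ _ lji lis Hz0.
by rewrite (rk_lt _ _ (ltn_ord j) Hz) => /esym/n_Sn.
Qed.

Lemma local_cycle_chain_bd (C : seq pmap -> k) s : local_cycle C -> chain_bd C s = 0.
Proof.
move=> HC; rewrite chain_bd_expand big1 // => i _.
by rewrite (drop_nth (fid n)) // HC mulr0.
Qed.

(** The four words of the last equation stand, in order, for [(a o b) o c], [a o (b o c)],
    [(a o c) o b] and [a o (c o b)]. *)
Definition prelie_word_fun (G : word -> k) :=
  [/\ forall w, ~~ complete w -> G w = 0,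
      forall w1 w2 p q p' q', p != p' -> p != q' -> q != p' -> q != q' ->
        G (w1 ++ (p, q) :: (p', q') :: w2) = G (w1 ++ (p', q') :: (p, q) :: w2) &
      forall w1 w2 a b c, a != b -> a != c -> b != c ->
        G (w1 ++ (b, a) :: (c, a) :: w2) - G (w1 ++ (c, b) :: (b, a) :: w2)
        - G (w1 ++ (c, a) :: (b, a) :: w2) + G (w1 ++ (b, c) :: (c, a) :: w2) = 0].

Lemma valid_swap x w p q p' q' : p != p' -> p != q' -> q != p' ->
  valid x ((p, q) :: (p', q') :: w) -> valid x ((p', q') :: (p, q) :: w).
Proof.
move=> pp' pq' qp'.
case/and4P=> /= /eqP xp /eqP xq pq /and4P[/eqP xp' /eqP xq' p'q' vw].
have [{}xp' _] := absorb_fix xq pq xp'; have [{}xq' _] := absorb_fix xq pq xq'.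
rewrite xp' xq' p'q' !absorbE xp xq (negbTE pp') (negbTE qp') !eqxx pq /=.
by rewrite -absorbC // eq_sym.
Qed.

Lemma complete_swap w1 w2 p q p' q' : p != p' -> p != q' -> q != p' ->
  complete (w1 ++ (p, q) :: (p', q') :: w2) = complete (w1 ++ (p', q') :: (p, q) :: w2).
Proof.
move=> pp' pq' qp'; rewrite /complete !size_cat !valid_cat; congr (_ && _ && _).
by apply/idP/idP; apply: valid_swap; rewrite // eq_sym.
Qed.

Lemma complete_chain w1 w2 a b c : a != b -> a != c -> b != c ->
  complete (w1 ++ (c, b) :: (b, a) :: w2) = complete (w1 ++ (b, a) :: (c, a) :: w2).
Proof.
move=> ab ac bc; have [ba ca cb] : [/\ b != a, c != a & c != b].
  by rewrite eq_sym ab eq_sym ac eq_sym bc.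
rewrite /complete !size_cat !valid_cat /= absorb_chain //; congr (_ && _ && _).
set x := wend _ w1; set V := valid _ w2; clearbody V x; rewrite ba ca cb.
apply/and4P/and4P => [[/eqP xc /eqP xb _ /and4P[_ ha _ ->]]
                         |[/eqP xb /eqP xa _ /and4P[/eqP hc _ _ ->]]].
  have [xa _] := absorb_fix xb cb (eqP ha).
  by split; rewrite ?absorbE ?xa ?xb ?xc ?(negbTE cb) ?(negbTE ab) ?eqxx.
have [xc _] := absorb_fix xa ba hc.
by split; rewrite ?absorbE ?xa ?xb ?xc ?(negbTE bc) ?(negbTE ac) ?eqxx.
Qed.

(** In a cycle the two sides of a square carry opposite coefficients; the sign of the order of
    disappearance makes them equal. *)
Definition word_fun (C : seq pmap -> k) w : k :=
  if complete w then (-1) ^+ list_sign [seq m.1 | m <- w] * C (wchain (fid n) w) else 0.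

Definition chain_fun (G : word -> k) s : k :=
  if maxchain s then
    let w := moves_of (fid n) s in (-1) ^+ list_sign [seq m.1 | m <- w] * G w
  else 0.

Lemma wend_idem x w : idem x -> valid x w -> idem (wend x w).
Proof.
elim: w x => //= m w IH x ix /and4P[/eqP x1 /eqP x2 m12 vw].
by rewrite IH // idem_absorb.
Qed.

Lemma maxchain_cov pre z y suf : maxchain (pre ++ z :: y :: suf) ->
  cov (last (fid n) pre) z && cov z y.
Proof. by case/andP; rewrite cat_path /= => /and4P[_ -> -> _]. Qed.

Lemma complete_uniq w : complete w ->
  uniq [seq m.1 | m <- w] /\ size [seq m.1 | m <- w] = n.-1.
Proof. by case/andP=> /valid_uniq[-> _] /eqP; rewrite size_map. Qed.

(** In the four words of the relator the points disappear in the orders [b, c], then [c, b] twice,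
    then [b, c]. The twist thus turns a sum of four coefficients into the pre-Lie relator. *)
Lemma word_fun_prelie (C : seq pmap -> k) : (forall s, C s != 0 -> maxchain s) ->
  local_cycle C -> prelie_word_fun (word_fun C).
Proof.
move=> HC loc; split.
- by move=> w; rewrite /word_fun => /negbTE ->.
- move=> w1 w2 p q p' q' pp' pq' qp' qq'.
  have p'q : p' != q by rewrite eq_sym.
  rewrite /word_fun complete_swap //; case: ifP => // c2.
  have c1 : complete (w1 ++ (p, q) :: (p', q') :: w2) by rewrite complete_swap.
  have := c1; rewrite /complete valid_cat.
  case/andP=> /andP[v1 /= /and4P[/eqP xp /eqP xq pq /and4P[/eqP xp' /eqP xq' p'q' _]]] _.
  have [{}xp' _] := absorb_fix xq pq xp'; have [{}xq' _] := absorb_fix xq pq xq'.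
  rewrite !wchain_cat /= (absorbC _ pp' pq' p'q).
  have := loc (wchain (fid n) w1) (absorb p q (absorb p' q' (wend (fid n) w1)))
    (wchain (absorb p q (absorb p' q' (wend (fid n) w1))) w2).
  rewrite -(absorbC _ pp' pq' p'q) (sum_disjoint xp xq xp' xq') //.
    have [U S] := complete_uniq c1; rewrite !map_cat /= in U S *.
    rewrite (list_sign_swap U S) signrN mulNr.
    move/eqP; rewrite addr_eq0 => /eqP ->.
    by rewrite mulrN.
  by move=> z /HC /maxchain_cov; rewrite last_wchain.
move=> w1 w2 a b c ab ac bc.
have ba : b != a by rewrite eq_sym.
have ca : c != a by rewrite eq_sym.
have cb : c != b by rewrite eq_sym.
rewrite /word_fun (complete_chain _ _ ab ac bc) (complete_chain _ _ ac ab cb).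
have E : complete (w1 ++ (c, a) :: (b, a) :: w2) = complete (w1 ++ (b, a) :: (c, a) :: w2).
  by rewrite complete_swap.
rewrite E; case: ifP => [c1|_]; last by rewrite !subr0 addr0.
have := c1; rewrite /complete valid_cat.
case/andP=> /andP[v1 /= /and4P[/eqP xb /eqP xa _ /and4P[/eqP xc _ _ _]]] _.
have [{}xc _] := absorb_fix xa ba xc.
rewrite !wchain_cat /= -(absorbC _ bc ba ca) (absorb_chain _ ac ab cb) (absorbC _ cb ca ba).
rewrite (absorb_chain _ ab ac bc).
have := loc (wchain (fid n) w1) (absorb c a (absorb b a (wend (fid n) w1)))
    (wchain (absorb c a (absorb b a (wend (fid n) w1))) w2).
rewrite (sum_triple xa xb xc) //; last first.
  by move=> z /HC /maxchain_cov; rewrite last_wchain.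
have [U S] := complete_uniq c1; rewrite !map_cat /= in U S *.
rewrite (list_sign_swap U S) signrN !mulNr !opprK -!mulrDr.
by move=> H; rewrite [X in X + _]addrAC H mulr0.
Qed.

Lemma chain_fun_wchain (G : word -> k) w1 w2 u v u' v' :
  let w := w1 ++ (u, v) :: (u', v') :: w2 in
  complete w ->
  chain_fun G (wchain (fid n) w) = (-1) ^+ list_sign [seq m.1 | m <- w] * G w.
Proof.
move=> w cw; rewrite /chain_fun maxchain_wchain // wchainK //.
by case/andP: cw.
Qed.

(** Any maximal chain through the gap supplies two consecutive moves, and their shape determines the
    interval and hence all terms of the equation. *)
Lemma chain_fun_local (G : word -> k) : prelie_word_fun G -> local_cycle (chain_fun G).
Proof.
move=> [G0 Gswap Gfour] pre y suf.
set S := \sum_z _; have [//|S0] := eqVneq S 0.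
have [z0 Cz0] : exists z, maxchain (pre ++ z :: y :: suf).
  apply/existsP; apply: contraNT S0; rewrite negb_exists => /forallP H.
  by rewrite /S big1 // => z _; rewrite /chain_fun (negbTE (H z)).
have cz z : chain_fun G (pre ++ z :: y :: suf) != 0 ->
    cov (last (fid n) pre) z && cov z y.
  by rewrite /chain_fun; case: ifP => [/maxchain_cov //|]; rewrite eqxx.
have := Cz0; rewrite /maxchain cat_path /=.
case/andP=> /andP[/path_cov_word[w1 v1 e1]] /and3P[xz0 z0y /path_cov_word[w2 v2 e2]] sz.
move: cz xz0; rewrite -e1 last_wchain; set x := wend _ w1 => cz xz0.
have [p [q [xp xq pq ez0]]] := covP xz0; have [p' [q' [xp' xq' p'q' ey]]] := covP z0y.
rewrite ez0 in xp' xq' ey.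
have [yp' p'p] := absorb_fix xq pq xp'; have [yq' q'p] := absorb_fix xq pq xq'.
rewrite yp' in p'p; rewrite yq' in q'p.
have szw : size (w1 ++ (p, q) :: (p', q') :: w2) == n.-1.
  by move: sz; rewrite -e1 -e2 !size_cat /= !size_wchain.
have cw : complete (w1 ++ (p, q) :: (p', q') :: w2).
  by rewrite /complete szw valid_cat v1 /= xp xq pq xp' xq' p'q' !eqxx -ey v2.
have pp' : p != p' by rewrite eq_sym.
have pq' : p != q' by rewrite eq_sym.
have val u v u' v' : y = absorb u' v' (absorb u v x) ->
    complete (w1 ++ (u, v) :: (u', v') :: w2) ->
    chain_fun G (pre ++ absorb u v x :: y :: suf) =
    (-1) ^+ list_sign [seq m.1 | m <- w1 ++ (u, v) :: (u', v') :: w2] *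
    G (w1 ++ (u, v) :: (u', v') :: w2).
  by move=> ey' /chain_fun_wchain <-; rewrite wchain_cat /= -ey' e1 e2.
have triple a b c : y = absorb c a (absorb b a x) ->
    x a = a -> x b = b -> x c = c -> a != b -> a != c -> b != c ->
    complete (w1 ++ (b, a) :: (c, a) :: w2) -> S = 0.
  move=> ey' xa xb xc ab ac bc c1.
  have ba : b != a by rewrite eq_sym.
  have ca : c != a by rewrite eq_sym.
  have cb : c != b by rewrite eq_sym.
  have c2 : complete (w1 ++ (c, a) :: (b, a) :: w2) by rewrite complete_swap.
  rewrite /S (sum_triple (F := fun z => chain_fun G (pre ++ z :: y :: suf)) xa xb xc) //.
    have ey2 : y = absorb b a (absorb c a x) by rewrite -(absorbC x bc ba ca).
    have ey3 : y = absorb b a (absorb c b x) by rewrite absorb_chain.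
    have ey4 : y = absorb c a (absorb b c x) by rewrite absorb_chain.
    have c3 : complete (w1 ++ (c, b) :: (b, a) :: w2) by rewrite complete_chain.
    have c4 : complete (w1 ++ (b, c) :: (c, a) :: w2) by rewrite complete_chain.
    rewrite (val _ _ _ _ ey' c1) (val _ _ _ _ ey2 c2) (val _ _ _ _ ey3 c3) (val _ _ _ _ ey4 c4).
    have [U s1] := complete_uniq c1; rewrite !map_cat /= in U s1 *.
    rewrite (list_sign_swap U s1) signrN !mulNr -!mulrBr -mulrDr.
    by rewrite [X in X + _]addrAC Gfour // mulr0.
  by rewrite -ey' -e1.
(* Chained moves and moves with a common absorber involve three blocks, with final point [q'] and
   [q] respectively; otherwise the moves are disjoint. *)
have [ep'q|np'q] := eqVneq p' q.
  have q'q : q' != q by rewrite eq_sym -ep'q.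
  have qp : q != p by rewrite eq_sym.
  apply: (triple q' q p) => //; first by rewrite ey ep'q absorb_chain.
  by rewrite -complete_chain //; move: cw; rewrite ep'q.
have [eq'q|nq'q] := eqVneq q' q.
  rewrite eq'q in ey cw p'q'.
  by apply: (triple q p p') => //; rewrite eq_sym.
have qp' : q != p' by rewrite eq_sym.
have qq' : q != q' by rewrite eq_sym.
rewrite /S (sum_disjoint (F := fun z => chain_fun G (pre ++ z :: y :: suf)) xp xq yp' yq') //.
  rewrite (val _ _ _ _ ey cw) (val p' q' p q); last 2 first.
  - by rewrite -absorbC.
  - by rewrite -complete_swap.
  have [U s1] := complete_uniq cw; rewrite !map_cat /= in U s1 *.
  by rewrite (list_sign_swap U s1) signrN mulNr Gswap // subrr.
by rewrite -ey -e1.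
Qed.

End Sums.
End Words.

(** * Trees and words of moves *)

(** The code gives trees decidable equality, so that forests can be compared up to permutation. *)
Fixpoint ptree_code n (t : ptree n) : GenTree.tree 'I_n :=
  match t with
  | Leaf i => GenTree.Leaf i
  | Node a b => GenTree.Node 0 [:: ptree_code a; ptree_code b]
  end.

Fixpoint ptree_decode n (c : GenTree.tree 'I_n) : option (ptree n) :=
  match c with
  | GenTree.Leaf i => Some (Leaf i)
  | GenTree.Node _ [:: a; b] =>
    if (ptree_decode a, ptree_decode b) is (Some a', Some b') then Some (Node a' b') else None
  | _ => None
  end.

Lemma ptree_codeK n : pcancel (@ptree_code n) (@ptree_decode n).
Proof. by elim=> //= a -> b ->. Qed.

HB.instance Definition _ n := Equality.copy (ptree n) (pcan_type (@ptree_codeK n)).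

Section Trees.
Variable n : nat.
Local Notation pmap := {ffun 'I_n -> 'I_n}.
Local Notation word := (seq ('I_n * 'I_n)).
Implicit Types (x y : pmap) (p q i : 'I_n) (w u v : word) (t a b c : ptree n).

(* [Node a b] records that the block of [a] absorbs that of [b] and keeps its point. *)
Fixpoint troot t : 'I_n := match t with Leaf i => i | Node a _ => troot a end.

Fixpoint tmoves t : word :=
  match t with
  | Leaf _ => [::]
  | Node a b => tmoves a ++ tmoves b ++ [:: (troot b, troot a)]
  end.

Definition track i w := foldl (fun i m => if i == m.1 then m.2 else i) i w.

Lemma track_cat i u v : track i (u ++ v) = track (track i u) v.
Proof. exact: foldl_cat. Qed.

Lemma wend_track x w i : wend x w i = track (x i) w.
Proof. by elim: w x => //= m w IH x; rewrite IH absorbE. Qed.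

Lemma troot_leaves t : troot t \in leaves t.
Proof. by elim: t => [i|a IHa b _] /=; rewrite ?inE // mem_cat IHa. Qed.

Lemma size_tmoves t : (size (tmoves t)).+1 = size (leaves t).
Proof.
by elim: t => [//|a IHa b IHb] /=; rewrite !size_cat /= -IHa -IHb addn1 addSn.
Qed.

Definition within (L : seq 'I_n) w := all (fun m => (m.1 \in L) && (m.2 \in L)) w.

Lemma within_sub (L L' : seq 'I_n) w : {subset L <= L'} -> within L w -> within L' w.
Proof.
by move=> LL' /allP H; apply/allP => m /H /andP[/LL' -> /LL' ->].
Qed.

Lemma within_tmoves t : within (leaves t) (tmoves t).
Proof.
elim: t => [//|a IHa b IHb] /=; rewrite /within !all_cat /= -!/(within _ _).
rewrite (within_sub _ IHa) ?(within_sub _ IHb) /= ?mem_cat ?troot_leaves ?orbT //.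
  by move=> i ib; rewrite mem_cat ib orbT.
by move=> i ib; rewrite mem_cat ib.
Qed.

Lemma track_notin i (L : seq 'I_n) w : within L w -> i \notin L -> track i w = i.
Proof.
elim: w => //= m w IH /andP[/andP[m1 _] wL] iL.
by case: eqP => [e|_]; [rewrite e m1 in iL|apply: IH].
Qed.

Lemma track_tmoves i t : uniq (leaves t) -> i \in leaves t -> track i (tmoves t) = troot t.
Proof.
elim: t => [j|a IHa b IHb] /=; first by rewrite inE => _ /eqP.
rewrite cat_uniq => /and3P[Ua /hasPn nab Ub]; rewrite !track_cat mem_cat.
have na : troot a \notin leaves b by apply/negP => /nab; rewrite /= troot_leaves.
have [ia _|nia /= ib] := boolP (i \in leaves a).
  by rewrite IHa // (track_notin (within_tmoves b)) //=; case: eqP.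
by rewrite (track_notin (within_tmoves a)) // IHb //= eqxx.
Qed.

Lemma valid_tmoves x t : uniq (leaves t) -> {in leaves t, forall i, x i = i} ->
  valid x (tmoves t).
Proof.
elim: t x => [//|a IHa b IHb] x /=.
rewrite cat_uniq => /and3P[Ua /hasPn nab Ub] xab; rewrite !valid_cat.
have xa : {in leaves a, forall i, x i = i} by move=> i ia; apply: xab; rewrite mem_cat ia.
have xb : {in leaves b, forall i, x i = i}.
  by move=> i ib; apply: xab; rewrite mem_cat ib orbT.
have nba i : i \in leaves b -> i \notin leaves a by move=> /nab.
rewrite IHa // IHb //=; last first.
  by move=> i ib; rewrite wend_track xb // (track_notin (within_tmoves a)) ?nba.
have ra := troot_leaves a; have rb := troot_leaves b.
have nra : troot a \notin leaves b by apply/negP => /nab; rewrite /= ra.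
rewrite !wend_track (xa _ ra) (xb _ rb) (track_notin (within_tmoves a) (nba _ rb)).
rewrite (track_tmoves Ua ra) (track_tmoves Ub rb) (track_notin (within_tmoves b) nra) !eqxx /= andbT.
by apply: contraNneq nra => <-.
Qed.

Lemma multilinear_uniq t : multilinear t -> uniq (leaves t).
Proof. by move=> /perm_uniq ->; apply: enum_uniq. Qed.

Lemma complete_tmoves t : multilinear t -> complete (tmoves t).
Proof.
move=> mt; rewrite /complete valid_tmoves ?multilinear_uniq //.
  have := size_tmoves t; rewrite (perm_size mt) size_enum_ord => e.
  by rewrite -[in X in _ == X]e eqxx.
by move=> i _; rewrite ffunE.
Qed.

Lemma plug_leaves (K : pctx n) :
  exists L L', forall t, leaves (plug K t) = L ++ leaves t ++ L'.
Proof.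
elim: K => [|K [L [L' E]] b|a K [L [L' E]]] /=.
- by exists [::], [::] => t; rewrite cats0.
- by exists L, (L' ++ leaves b) => t; rewrite E !catA.
by exists (leaves a ++ L), L' => t; rewrite E !catA.
Qed.

(** A context sees the plugged tree only through its root, and the four trees of a relator all have
    the root of [a]. *)
Lemma plug_moves (K : pctx n) r : exists u v r', forall t, troot t = r ->
  tmoves (plug K t) = u ++ tmoves t ++ v /\ troot (plug K t) = r'.
Proof.
elim: K => [|K [u [v [r' E]]] b|a K [u [v [r' E]]]] /=.
- by exists [::], [::], r => t; rewrite cats0.
- exists u, (v ++ tmoves b ++ [:: (troot b, r')]), r' => t /E[-> ->].
  by rewrite !catA.
exists (tmoves a ++ u), (v ++ [:: (r', troot a)]), (troot a) => t /E[-> ->].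
by rewrite !catA.
Qed.

Definition disjoint_moves (m m' : 'I_n * 'I_n) :=
  [&& m.1 != m'.1, m.1 != m'.2, m.2 != m'.1 & m.2 != m'.2].

Lemma within_disjoint (L L' : seq 'I_n) u v : ~~ has (mem L) L' ->
  within L u -> within L' v -> allrel disjoint_moves u v.
Proof.
move=> /hasPn LL' /allP Lu /allP Lv; apply/allrelP => m m' /Lu/andP[m1 m2] /Lv/andP[m1' m2'].
have neq i j : i \in L -> j \in L' -> i != j.
  by move=> iL jL; apply: contraTneq iL => ->; apply: LL'.
by rewrite /disjoint_moves !neq.
Qed.

(** * From functions of words to functionals on trees *)

Section WordFunctions.
Variables (k : nzRingType) (G : word -> k).
Hypothesis HG : prelie_word_fun G.

Lemma word_move w1 m v w2 : all (disjoint_moves m) v ->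
  G (w1 ++ m :: v ++ w2) = G (w1 ++ v ++ m :: w2).
Proof.
have [_ sw _] := HG; case: m => p q; elim: v w1 => //= -[p' q'] v IH w1.
case/andP=> /and4P[/= pp' pq' qp' qq'] Hv; rewrite sw //.
by rewrite -cat_rcons IH // cat_rcons.
Qed.

Lemma word_commute w1 u v w2 : allrel disjoint_moves u v ->
  G (w1 ++ u ++ v ++ w2) = G (w1 ++ v ++ u ++ w2).
Proof.
elim: u w1 => //= m u IH w1; rewrite allrel_consl => /andP[mv uv].
by rewrite -cat_rcons IH // cat_rcons -word_move.
Qed.

Definition tree_fun t : k := if multilinear t then G (tmoves t) else 0.

(** Moves on disjoint sets of leaves commute, so all four tree words can be brought to the prefix
    [W], two moves among the roots of [a], [b], [c], and a common suffix. *)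
Lemma tree_fun_prelie : in_prelie_dual tree_fun.
Proof.
have [G0 _ four] := HG; split=> [t /negbTE|K a b c]; first by rewrite /tree_fun => ->.
have [L [L' EL]] := plug_leaves K; have [u [v [r Er]]] := plug_moves K (troot a).
have Em t : troot t = troot a -> tmoves (plug K t) = u ++ tmoves t ++ v by case/Er.
set t1 := plug K (Node (Node a b) c); set t2 := plug K _; set t3 := plug K _.
set t4 := plug K _.
have [m2 m3 m4] : [/\ multilinear t2 = multilinear t1, multilinear t3 = multilinear t1
                    & multilinear t4 = multilinear t1].
  split; apply: (permPl _ (enum 'I_n)); rewrite /t1 /t2 /t3 /t4 !EL /= perm_cat2l perm_cat2r -!catA //.
    by rewrite perm_cat2l perm_catC.
  by rewrite perm_cat2l perm_catC.
rewrite /tree_fun m2 m3 m4; case: ifP => [/multilinear_uniq|]; last by rewrite !subr0 addr0.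
rewrite /t1 EL cat_uniq => /and3P[_ _]; rewrite cat_uniq => /and3P[+ _ _].
rewrite /= cat_uniq => /and3P[+ nabc _]; rewrite cat_uniq => /and3P[_ nab _].
have {nabc} [nac nbc] : ~~ has (mem (leaves a)) (leaves c) /\ ~~ has (mem (leaves b)) (leaves c).
  by split; apply: contra nabc => /hasP[i ic /= ii]; apply/hasP; exists i;
     rewrite //= mem_cat ii ?orbT.
have neq d e : ~~ has (mem (leaves d)) (leaves e) -> troot d != troot e.
  by move/hasPn/(_ _ (troot_leaves e)); apply: contraNneq => <-; apply: troot_leaves.
have [ab ac bc] : [/\ troot a != troot b, troot a != troot c & troot b != troot c].
  by rewrite !neq.
have hasC d e : ~~ has (mem (leaves d)) (leaves e) -> ~~ has (mem (leaves e)) (leaves d).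
  by rewrite has_sym.
pose W := u ++ tmoves a ++ tmoves b ++ tmoves c.
have disj d e f : ~~ has (mem (leaves f)) (leaves d) -> ~~ has (mem (leaves f)) (leaves e) ->
    all (disjoint_moves (troot d, troot e)) (tmoves f).
  move=> nd ne; have H : within (leaves d ++ leaves e) [:: (troot d, troot e)].
    by rewrite /= !mem_cat !troot_leaves orbT.
  have : allrel disjoint_moves [:: (troot d, troot e)] (tmoves f).
    apply: within_disjoint H (within_tmoves f); rewrite has_sym has_cat negb_or.
    by rewrite nd.
  by rewrite allrel1l.
have e1 : G (tmoves t1) = G (W ++ (troot b, troot a) :: (troot c, troot a) :: v).
  rewrite Em //= /W -!catA /=.
  by have := @word_move (u ++ tmoves a ++ tmoves b) (troot b, troot a) (tmoves c) ((troot c, troot a) :: v);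
     rewrite -!catA; apply; apply: disj; apply: hasC.
have e2 : G (tmoves t2) = G (W ++ (troot c, troot b) :: (troot b, troot a) :: v).
  by rewrite Em //= /W -!catA.
have swap w : G (u ++ tmoves a ++ tmoves c ++ tmoves b ++ w) = G (W ++ w).
  have := @word_commute (u ++ tmoves a) (tmoves c) (tmoves b) w.
  rewrite /W -!catA; apply.
  by apply: within_disjoint (within_tmoves c) (within_tmoves b); apply: hasC.
have e3 : G (tmoves t3) = G (W ++ (troot c, troot a) :: (troot b, troot a) :: v).
  rewrite -swap Em //= -!catA /=.
  have := @word_move (u ++ tmoves a ++ tmoves c) (troot c, troot a) (tmoves b) ((troot b, troot a) :: v).
  by rewrite -!catA; apply; apply: disj => //; apply: hasC.
have e4 : G (tmoves t4) = G (W ++ (troot b, troot c) :: (troot c, troot a) :: v).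
  by rewrite -swap Em //= -!catA /=.
by rewrite e1 e2 e3 e4 four.
Qed.

(** * Regrouping the moves of a word into a forest *)

Definition forest_moves (F : seq (ptree n)) := flatten [seq tmoves t | t <- F].
Definition forest_leaves (F : seq (ptree n)) := flatten [seq leaves t | t <- F].

Lemma within_forest F : within (forest_leaves F) (forest_moves F).
Proof.
elim: F => //= t F IH; rewrite /within all_cat -!/(within _ _).
rewrite (within_sub _ (within_tmoves t)) ?(within_sub _ IH) // => i ii.
  by rewrite mem_cat ii orbT.
by rewrite mem_cat ii.
Qed.

Lemma track_forest F t i : uniq (forest_leaves F) -> t \in F -> i \in leaves t ->
  track i (forest_moves F) = troot t.
Proof.
elim: F => //= t' F IH; rewrite cat_uniq track_cat => /and3P[Ut /hasPn nt UF].
rewrite inE => /predU1P[-> it|tF it].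
  rewrite track_tmoves // (track_notin (within_forest F)) //.
  by apply/negP => /nt; rewrite /= troot_leaves.
rewrite (track_notin (within_tmoves t')) ?IH //; apply: nt.
by apply/flattenP; exists (leaves t) => //; apply: map_f.
Qed.

(** Permutations are generated by exchanges of blocks of trees, and the words of disjoint trees
    commute. *)
Lemma forest_perm F F' w : perm_eq F F' -> uniq (forest_leaves F) ->
  G (forest_moves F ++ w) = G (forest_moves F' ++ w).
Proof.
move=> FF' UF; pose P F' := uniq (forest_leaves F') /\
  G (forest_moves F ++ w) = G (forest_moves F' ++ w).
suff : P F' by case.
apply: (@catCA_perm_ind _ P _ F F' FF') => // s1 s2 s3 [].
rewrite /P /forest_leaves /forest_moves !map_cat !flatten_cat.
rewrite -!/(forest_leaves _) -!/(forest_moves _) uniq_catCA => U ->; split=> //.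
rewrite -!catA; apply: (@word_commute [::]).
apply: within_disjoint (within_forest s1) (within_forest s2).
by move: U; rewrite cat_uniq has_cat negb_or has_sym => /and3P[_ /andP[]].
Qed.

(** Each move of [w] joins two trees of the forest at their roots, so grafting consumes [w] until a
    single tree remains. *)
Lemma word_zero_forest : (forall t, multilinear t -> G (tmoves t) = 0) ->
  forall w F, perm_eq (forest_leaves F) (enum 'I_n) -> size F = (size w).+1 ->
  G (forest_moves F ++ w) = 0.
Proof.
move=> Gt; have [G0 _ _] := HG; elim=> [|[p q] w IH] F HF.
  case: F HF => [|t [|]] //=; rewrite /forest_leaves /forest_moves /= !cats0 => mt _.
  exact: Gt.
move=> szF; have UF : uniq (forest_leaves F) by rewrite (perm_uniq HF) enum_uniq.
have [|/G0//] := boolP (complete (forest_moves F ++ (p, q) :: w)).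
rewrite /complete valid_cat /= => /andP[/andP[_ /and4P[xp xq pq _]] _].
(* A point of the partition reached so far is the root of the tree that contains it. *)
have find r : wend (fid n) (forest_moves F) r == r -> exists2 t, t \in F & troot t = r.
  rewrite wend_track ffunE => /eqP tr.
  have : r \in forest_leaves F by rewrite (perm_mem HF) mem_enum.
  case/flattenP => _ /mapP[t tF ->] rt; exists t => //.
  by rewrite -tr; apply/esym/track_forest.
have [[tp tpF ep] [tq tqF eq]] := (find p xp, find q xq).
have ntpq : tp != tq by apply: contraNneq pq => e; rewrite -ep -eq e.
have [F' FF'] : exists F', perm_eq F (tq :: tp :: F').
  exists (rem tp (rem tq F)); apply: perm_trans (perm_to_rem tqF) _.
  rewrite perm_cons; apply: perm_to_rem.
  by move: tpF; rewrite (perm_mem (perm_to_rem tqF)) inE (negbTE ntpq).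
have LF : perm_eq (forest_leaves (tq :: tp :: F')) (forest_leaves F).
  by apply: perm_flatten; apply: perm_map; rewrite perm_sym.
rewrite (forest_perm _ FF' UF).
have U : uniq (forest_leaves (tq :: tp :: F')) by rewrite (perm_uniq LF).
have -> : G (forest_moves (tq :: tp :: F') ++ (p, q) :: w) =
          G (forest_moves (Node tq tp :: F') ++ w).
  (* The move [(p, q)] slides left past the other trees and becomes the last move of
     [Node tq tp]. *)
  rewrite /forest_moves /= -!/(forest_moves _) -!catA /= ep eq.
  have := @word_move (tmoves tq ++ tmoves tp) (p, q) (forest_moves F') w.
  rewrite -!catA => <- //.
  have : allrel disjoint_moves [:: (p, q)] (forest_moves F').
    have H : within (leaves tq ++ leaves tp) [:: (p, q)].
      by rewrite /= !mem_cat -ep -eq !troot_leaves orbT.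
    apply: within_disjoint H (within_forest F').
    by move: U; rewrite /forest_leaves /= catA cat_uniq => /and3P[].
  by rewrite allrel1l.
apply: IH.
  rewrite -(permPr HF) -(permPr LF) /forest_leaves /= -catA.
  exact: perm_refl.
by apply/eqP; rewrite -eqSS -szF (perm_size FF').
Qed.

(** The induction starts from the forest of [n] single leaves, whose own word is empty. *)
Lemma word_zero w (r0 : 'I_n) : (forall t, multilinear t -> G (tmoves t) = 0) -> G w = 0.
Proof.
move=> Gt; have [G0 _ _] := HG.
have [|/G0//] := boolP (complete w); case/andP => _ /eqP szw.
have e : forest_moves [seq Leaf i | i <- enum 'I_n] = [::].
  by rewrite /forest_moves; elim: (enum _).
rewrite -[w]/([::] ++ w) -e; apply: word_zero_forest => //.
  rewrite /forest_leaves -map_comp (eq_map (g := fun i => [:: i])) //.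
  by rewrite flatten_map1 map_id perm_refl.
by rewrite size_map size_enum_ord szw prednK // (leq_ltn_trans _ (ltn_ord r0)).
Qed.

End WordFunctions.

(** * Rebuilding a tree from a word *)

Definition graft (St : 'I_n -> ptree n) (m : 'I_n * 'I_n) : 'I_n -> ptree n :=
  fun i => if i == m.2 then Node (St m.2) (St m.1)
           else if i == m.1 then Leaf m.1 else St i.

(** Along a valid word started from [Leaf], slot [i] holds the tree built so far on the block
    pointed at [i]. *)
Definition build (St : 'I_n -> ptree n) w := foldl graft St w.

Definition replace_at (St : 'I_n -> ptree n) p t : 'I_n -> ptree n :=
  fun i => if i == p then t else St i.

Lemma eq_graft St St' m : St =1 St' -> graft St m =1 graft St' m.
Proof. by move=> E i; rewrite /graft !E. Qed.

Lemma eq_build St St' w : St =1 St' -> build St w =1 build St' w.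
Proof. by elim: w St St' => //= m w IH St St' /(eq_graft m)/IH. Qed.

Lemma build_cat St u v : build St (u ++ v) = build (build St u) v.
Proof. exact: foldl_cat. Qed.

Lemma graftC St m m' : disjoint_moves m m' ->
  graft (graft St m) m' =1 graft (graft St m') m.
Proof.
case: m m' => [p q] [p' q'] /and4P[/= pp' pq' qp' qq'] i; rewrite /graft /=.
rewrite (negbTE pp') (negbTE pq') (negbTE qp') (negbTE qq') ![_ == p]eq_sym ![_ == q]eq_sym.
rewrite (negbTE pp') (negbTE pq') (negbTE qp') (negbTE qq').
have [<-|qi] := eqVneq q i; first by rewrite (negbTE qq') (negbTE qp').
by have [<-|//] := eqVneq p i; rewrite (negbTE pq') (negbTE pp').
Qed.

Fixpoint plug_ctx (K K' : pctx n) : pctx n :=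
  match K with
  | Hole => K'
  | CtxL K1 b => CtxL (plug_ctx K1 K') b
  | CtxR a K1 => CtxR a (plug_ctx K1 K')
  end.

Lemma plug_plug (K K' : pctx n) t : plug (plug_ctx K K') t = plug K (plug K' t).
Proof. by elim: K => //= [K -> b|a K ->]. Qed.

(* [graft] resets the slot of the absorbed point, so that a change in one slot never
   spreads to two. *)
Lemma build_plug x St w (a : 'I_n) : valid x w -> x a = a ->
  exists K, forall t, build (replace_at St a t) w (track a w) = plug K t.
Proof.
elim: w x St a => [|[p q] w IH] x St a /=.
  by exists Hole => t; rewrite /replace_at eqxx.
case/and4P=> /eqP xp /eqP xq pq vw xa; have qp : q != p by rewrite eq_sym.
have [eap|nap] := eqVneq a p.
  have xq' : absorb p q x q = q by rewrite absorbE xq (negbTE qp).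
  have [K HK] := IH _ (graft St (p, q)) q vw xq'.
  exists (plug_ctx K (CtxR (St q) Hole)) => t; rewrite plug_plug /= -HK.
  apply: eq_build => i; rewrite /graft /replace_at /= eap eqxx (negbTE qp).
  by case: eqP => // _; case: eqP.
have xa' : absorb p q x a = a by rewrite absorbE xa (negbTE nap).
have [K HK] := IH _ (graft St (p, q)) a vw xa'.
have [eaq|naq] := eqVneq a q.
  exists (plug_ctx K (CtxL Hole (St p))) => t; rewrite plug_plug /= -HK.
  apply: eq_build => i; rewrite /graft /replace_at /= eaq eqxx [p == q]eq_sym (negbTE qp).
  by case: eqP.
exists K => t; rewrite -HK; apply: eq_build => i; rewrite /graft /replace_at /=.
rewrite ![_ == a]eq_sym (negbTE nap) (negbTE naq).
by case: (eqVneq a i) => [<-|//]; rewrite (negbTE nap) (negbTE naq).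
Qed.

(** Stated for every slot, since the induction on the right subtree needs the left one to have left
    its leaves untouched. *)
Lemma build_tmoves St t : uniq (leaves t) -> {in leaves t, forall i, St i = Leaf i} ->
  forall i, build St (tmoves t) i =
    if i == troot t then t else if i \in leaves t then Leaf i else St i.
Proof.
elim: t St => [j|a IHa b IHb] St /=.
  move=> _ Sj i; rewrite inE; case: (eqVneq i j) => [->|//].
  by rewrite Sj ?inE.
rewrite cat_uniq => /and3P[Ua /hasPn nab Ub] Sab i; rewrite !build_cat /=.
have Sa : {in leaves a, forall i, St i = Leaf i} by move=> j ja; apply: Sab; rewrite mem_cat ja.
have nba j : j \in leaves b -> j \notin leaves a by move=> /nab.
have Sb : {in leaves b, forall i, build St (tmoves a) i = Leaf i}.
  move=> j jb; rewrite (IHa _ Ua Sa) (negbTE (nba _ jb)) Sab ?mem_cat ?jb ?orbT //.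
  by case: eqP => // e; move: (nba _ jb); rewrite e troot_leaves.
have ra := troot_leaves a; have rb := troot_leaves b.
have nra : troot a \notin leaves b by apply/negP => /nab; rewrite /= ra.
have nrab : troot a != troot b by apply: contraNneq nra => ->.
rewrite /graft /= !(IHb _ Ub Sb) !(IHa _ Ua Sa) eqxx (negbTE nrab) (negbTE nra) eqxx mem_cat.
case: (eqVneq i (troot a)) => // nia; case: (eqVneq i (troot b)) => [->|nib].
  by rewrite rb orbT.
by case: (i \in leaves b); rewrite ?orbT ?orbF.
Qed.

Lemma rk_wend x w : idem x -> valid x w -> rk (wend x w) = (rk x + size w)%N.
Proof.
move=> ix vw; rewrite -last_wchain -(size_wchain x).
elim/last_ind: (wchain x w) (path_wchain ix vw) => [|s y _] Hp; first by rewrite addn0.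
have := @rk_nth n x (rcons s y) (size s) Hp; rewrite size_rcons => /(_ (ltnSn _)).
by rewrite nth_rcons ltnn eqxx last_rcons.
Qed.

Lemma idem_rk_const x i j : idem x -> rk x = n.-1 -> x i = x j.
Proof.
move=> /idemP ix rx; apply/eqP; apply: contraT => xij.
have := cardC [pred l | x l == l]; rewrite card_ord.
have -> : #|[predC [pred l | x l == l]]| = n.-1 by rewrite -rx; apply: eq_card.
rewrite (cardD1 (x i)) (cardD1 (x j)) !inE !ix !eqxx eq_sym xij => e.
have n0 : (0 < n)%N := leq_ltn_trans (leq0n _) (ltn_ord i).
rewrite -[X in _ = X](prednK n0) !add1n !addSn /= in e.
by case: e => /eqP; rewrite gtn_eqF // ltnS leq_addl.
Qed.

(** A complete word ends with a single block, so tracking from any index finds its point;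
    [word_tree] can therefore start at an arbitrary [r0]. *)
Lemma complete_track w i j : complete w -> track i w = track j w.
Proof.
case/andP=> vw /eqP szw; have := @idem_rk_const (wend (fid n) w) i j.
rewrite !wend_track !ffunE; apply; first exact: wend_idem (idem_fid n) vw.
by rewrite rk_wend ?idem_fid // rk_fid szw.
Qed.

Section TreeFunctions.
Variables (k : nzRingType) (phi : ptree n -> k) (r0 : 'I_n).

Definition word_tree w := build Leaf w (track r0 w).

Definition tree_word w : k := if complete w then phi (word_tree w) else 0.

Lemma word_tree_tmoves t : multilinear t -> word_tree (tmoves t) = t.
Proof.
move=> mt; have Ut := multilinear_uniq mt.
rewrite /word_tree (track_tmoves Ut) ?(perm_mem mt) ?mem_enum //.
by rewrite (build_tmoves Ut) ?eqxx.
Qed.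

Lemma tree_word_tmoves t : multilinear t -> tree_word (tmoves t) = phi t.
Proof. by move=> mt; rewrite /tree_word complete_tmoves // word_tree_tmoves. Qed.

(** Disjoint moves act on different slots, hence the exchanges. In the relator, all four pairs of
    moves reset slots [b] and [c] and differ only in the tree at [a], so one context [K] serves for
    all. *)
Lemma tree_word_prelie : in_prelie_dual phi -> prelie_word_fun tree_word.
Proof.
move=> [_ rel]; split.
- by move=> w; rewrite /tree_word => /negbTE ->.
- move=> w1 w2 p q p' q' pp' pq' qp' qq'; rewrite /tree_word complete_swap //.
  case: ifP => // _; congr phi; rewrite /word_tree !track_cat !build_cat /=.
  have p'q : p' == q = false by rewrite eq_sym (negbTE qp').
  have q'p : q' == p = false by rewrite eq_sym (negbTE pq').
  set r := track r0 w1; have -> : (if (if r == p then q else r) == p' then q'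
      else if r == p then q else r) =
      (if (if r == p' then q' else r) == p then q else if r == p' then q' else r).
    case: (eqVneq r p) => [->|rp]; first by rewrite (negbTE pp') eqxx (negbTE qp').
    by case: (eqVneq r p') => _; rewrite ?q'p // (negbTE rp).
  by apply: eq_build; apply: graftC; rewrite /disjoint_moves /= pp' pq' qp' qq'.
move=> w1 w2 a b c ab ac bc.
have ba : b != a by rewrite eq_sym.
have ca : c != a by rewrite eq_sym.
have cb : c != b by rewrite eq_sym.
rewrite /tree_word (complete_chain _ _ ab ac bc) (complete_chain _ _ ac ab cb).
have E : complete (w1 ++ (c, a) :: (b, a) :: w2) = complete (w1 ++ (b, a) :: (c, a) :: w2).
  by rewrite complete_swap.
rewrite E; case: ifP => [c1|_]; last by rewrite !subr0 addr0.
have c2 : complete (w1 ++ (c, a) :: (b, a) :: w2) by rewrite E.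
have c3 : complete (w1 ++ (c, b) :: (b, a) :: w2) by rewrite complete_chain.
have c4 : complete (w1 ++ (b, c) :: (c, a) :: w2) by rewrite complete_chain.
have := c1; rewrite /complete valid_cat.
case/andP=> /andP[v1 /= /and4P[/eqP xb /eqP xa _ /and4P[/eqP xc /eqP ya _ v2]]] _.
have {}ya : absorb c a (absorb b a (wend (fid n) w1)) a = a.
  by rewrite absorbE ya (negbTE ac).
have ta : track a w1 = a by rewrite -[LHS]/(track a w1) -{1}(ffunE id a) -wend_track.
pose St := build Leaf w1.
pose base := fun i => if i == b then Leaf b else if i == c then Leaf c else St i.
have [K HK] := build_plug base v2 ya.
have val (u v u' v' : 'I_n) t : complete (w1 ++ (u, v) :: (u', v') :: w2) ->
    u != a -> u' != a -> graft (graft St (u, v)) (u', v') =1 replace_at base a t ->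
    word_tree (w1 ++ (u, v) :: (u', v') :: w2) = plug K t.
  move=> cw ua u'a Et; rewrite /word_tree (complete_track r0 a cw).
  rewrite track_cat ta build_cat /= [a == u]eq_sym (negbTE ua) [a == u']eq_sym (negbTE u'a).
  by rewrite -HK; apply: eq_build.
pose nE := (negbTE ab, negbTE ac, negbTE bc, negbTE ba, negbTE ca, negbTE cb, eqxx).
rewrite (val _ _ _ _ (Node (Node (St a) (St b)) (St c)) c1) //; last first.
  move=> i; rewrite /graft /replace_at /base /= !nE; case: (eqVneq i a) => // _.
  by case: (eqVneq i c) => [->|//]; rewrite nE.
rewrite (val _ _ _ _ (Node (St a) (Node (St b) (St c))) c3) //; last first.
  move=> i; rewrite /graft /replace_at /base /= !nE; case: (eqVneq i a) => // _.
  by case: (eqVneq i b).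
rewrite (val _ _ _ _ (Node (Node (St a) (St c)) (St b)) c2) //; last first.
  by move=> i; rewrite /graft /replace_at /base /= !nE; case: (eqVneq i a) => // _.
rewrite (val _ _ _ _ (Node (St a) (Node (St c) (St b))) c4) //; last first.
  move=> i; rewrite /graft /replace_at /base /= !nE; case: (eqVneq i a) => // _.
  by case: (eqVneq i c) => [->|//]; rewrite nE.
Qed.

End TreeFunctions.

End Trees.

(** * The encoding of chains *)

Section Encoding.
Variable n : nat.
Local Notation pmap := {ffun 'I_n -> 'I_n}.
Implicit Types (f g h : pmap) (i j : 'I_n) (s u : seq pmap) (x : PP n).

(* An idempotent map encodes the pointed partition into its fibres, pointed at its fixed points. *)
Definition enc f : PP n := (preim_partition f [set: 'I_n], [set i | f i == i]).

(** The default [i] occurs only if the block of [i] has no emphasized element, which a pointed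
    partition excludes. *)
Definition dec x : pmap := [ffun i => odflt i [pick j in pblock x.1 i :&: x.2]].

Lemma enc_blockP f (B : {set 'I_n}) :
  reflect (exists i, B = [set j | f i == f j]) (B \in (enc f).1).
Proof.
have E i : [set j in [set: 'I_n] | f i == f j] = [set j | f i == f j].
  by apply/setP => j; rewrite !inE.
apply: (iffP imsetP) => [[i _ ->]|[i ->]]; first by exists i; rewrite E.
by exists i; rewrite ?inE // E.
Qed.

Lemma enc_pointed f : idem f -> pointed_partition (enc f).
Proof.
move=> /idemP If; rewrite /pointed_partition (preim_partitionP f) /=; apply/andP; split.
  apply/forall_inP => B /enc_blockP[i ->]; apply/cards1P; exists (f i).
  apply/setP => j; rewrite !inE; apply/andP/eqP => [[/eqP -> /eqP ->]//|->].
  by rewrite If !eqxx.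
by rewrite (cover_partition (preim_partitionP f _)) subsetT.
Qed.

Lemma decP x i : pointed_partition x ->
  [/\ dec x i \in pblock x.1 i, dec x i \in x.2 &
      forall j, j \in pblock x.1 i -> j \in x.2 -> j = dec x i].
Proof.
case/andP=> /andP[px /forall_inP H] _.
have cov : i \in cover x.1 by rewrite (cover_partition px) inE.
have /cards1P[j Ej] := H _ (pblock_mem cov).
have Ed : dec x i = j.
  rewrite ffunE; case: pickP => [j'|/(_ j)]; first by rewrite Ej inE => /eqP.
  by rewrite Ej inE eqxx.
have := set11 j; rewrite -Ej -Ed inE => /andP[-> ->]; split=> // j' jb jx.
by apply/set1P; rewrite Ed -Ej inE jb jx.
Qed.

Lemma enc_pblock f i j : (j \in pblock (enc f).1 i) = (f i == f j).
Proof.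
rewrite pblock_equivalence_partition ?inE //.
by split=> // /eqP ->.
Qed.

Lemma encK f : idem f -> dec (enc f) = f.
Proof.
move=> If; apply/ffunP => i; have [+ + _] := decP i (enc_pointed If).
by rewrite enc_pblock inE => /eqP -> /eqP.
Qed.

Lemma dec_idem x : pointed_partition x -> idem (dec x).
Proof.
move=> px; apply/idemP => i; have [b1 p1 _] := decP i px; have [b2 p2 H] := decP (dec x i) px.
have /andP[/andP[part _] _] := px; have [_ tI _] := and3P part.
by apply/esym/H; rewrite // mem_pblock (cover_partition part) inE.
Qed.

Lemma decK x : pointed_partition x -> enc (dec x) = x.
Proof.
move=> px; have /andP[/andP[part _] _] := px; have [_ /eqP tI _] := and3P part.
have cv i : i \in cover x.1 by rewrite (cover_partition part) inE.
have {}tI : trivIset x.1 by apply/eqP.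
rewrite /enc; have -> : [set i | dec x i == i] = x.2.
  apply/setP => i; rewrite inE; have [_ px2 H] := decP i px.
  apply/eqP/idP => [<- //|ix]; apply/esym/H => //.
  by rewrite mem_pblock.
rewrite [RHS]surjective_pairing; congr pair.
rewrite -[RHS](equivalence_partition_pblock part).
apply: eq_in_imset => i _; apply/setP => j; rewrite !inE /=.
have [b1 p1 H1] := decP i px; have [b2 p2 H2] := decP j px.
apply/eqP/idP => [e|jb].
  by rewrite -eq_pblock // -(same_pblock tI b1) e (same_pblock tI b2) eqxx.
by apply/H2 => //; rewrite (same_pblock tI jb).
Qed.

(** The encoding reverses the order: the identity, least for [coarser], encodes the maximal pointed
    partition. *)
Lemma pp_le_enc f g : idem f -> idem g -> pp_le (enc g) (enc f) = coarser f g.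
Proof.
move=> If Ig; apply/andP/coarserP => [[/forall_inP H /subsetP S]|[_ _ gf fg]].
  split=> // i; last by apply/eqP; move: (S (g i)); rewrite !inE (idemP _ Ig) eqxx; apply.
  have /H/exists_inP[B /enc_blockP[l ->] /subsetP sub] : [set j | f i == f j] \in (enc f).1.
    by apply/enc_blockP; exists i.
  move: (sub i) (sub (f i)); rewrite !inE (idemP _ If) eqxx.
  by move=> /(_ isT)/eqP <- /(_ isT)/eqP <-.
split; last by apply/subsetP => i; rewrite !inE => /eqP gi; rewrite -{1}gi fg gi.
apply/forall_inP => B /enc_blockP[i ->]; apply/exists_inP.
exists [set j | g i == g j]; first by apply/enc_blockP; exists i.
by apply/subsetP => j; rewrite !inE -(gf i) -(gf j) => /eqP ->.
Qed.

Lemma pp_lt_enc f g : idem f -> idem g -> pp_lt (enc g) (enc f) = scoarser f g.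
Proof.
move=> If Ig; rewrite /pp_lt /scoarser pp_le_enc //; congr (~~ _ && _).
by apply/eqP/eqP => [e|-> //]; rewrite -(encK If) -e encK.
Qed.

Lemma pointed_forall (Q : pred (PP n)) :
  [forall mu : PP n, pointed_partition mu ==> Q mu] = [forall f : pmap, idem f ==> Q (enc f)].
Proof.
apply/forall_inP/forall_inP => [H f If|H x px]; first exact/H/enc_pointed.
by rewrite -(decK px); apply/H/dec_idem.
Qed.

Lemma pp_maximal_enc f : idem f -> pp_maximal (enc f) = (f == fid n).
Proof.
move=> If; rewrite /pp_maximal enc_pointed //= pointed_forall.
apply/forall_inP/eqP => [H|-> h Ih].
  apply/esym/eqP; move: (H _ (idem_fid n)); rewrite pp_lt_enc ?idem_fid //.
  apply: contraR => nf; rewrite /scoarser nf; apply/coarserP; rewrite idem_fid.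
  by split=> // i; rewrite !ffunE.
rewrite pp_lt_enc ?idem_fid //; apply/negP => /rk_scoarser.
by rewrite rk_fid.
Qed.

Lemma rk_idem f : idem f -> (rk f <= n.-1)%N.
Proof.
move=> /idemP If; rewrite /rk; case: (posnP n) => [n0|n0].
  by rewrite (leq_trans (max_card _)) // card_ord n0.
have [r _] : {r : 'I_n | true} by exists (Ordinal n0).
rewrite -ltnS (prednK n0) -[X in (_ < X)%N](card_ord n).
by apply: proper_card; apply/properP; split; [apply/subsetP|exists (f r); rewrite ?inE ?If ?eqxx].
Qed.

(** At smaller rank two points remain, and absorbing one into the other gives a strictly smaller
    pointed partition. *)
Lemma pp_minimal_enc f : idem f -> pp_minimal (enc f) = (rk f == n.-1).
Proof.
move=> If; rewrite /pp_minimal enc_pointed //= pointed_forall.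
apply/forall_inP/eqP => [H|rf h Ih]; last first.
  rewrite pp_lt_enc //; apply/negP => /rk_scoarser.
  by rewrite rf ltnNge rk_idem.
apply/eqP; rewrite eqn_leq rk_idem //= leqNgt; apply/negP => ltr.
have /card_gt1P[p [q [fp fq pq]]] : (1 < #|[pred i | f i == i]|)%N.
  have := cardC [pred i | f i == i]; rewrite card_ord.
  have -> : #|[predC [pred i | f i == i]]| = rk f by apply: eq_card.
  move=> e; rewrite ltnNge; apply/negP => le1; move: ltr; rewrite -[in n.-1]e.
  by case: #|_| le1 => [|[|]] //= _; rewrite ?add0n ?ltnn // ltnNge leq_pred.
rewrite !inE in fp fq; have c := cov_absorb If (eqP fp) (eqP fq) pq.
have [_ Ia] := cov_idem c; have := H _ Ia; rewrite pp_lt_enc //.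
by case/andP: c => ->.
Qed.

Definition pchain s := path (@scoarser n) (fid n) s && (rk (last (fid n) s) == n.-1).

(** The reversal matches the opposite orders; the implicit [fid n] becomes the maximal last
    entry. *)
Definition enc_chain s : seq (PP n) := rev [seq enc f | f <- fid n :: s].

Lemma path_scoarser_idem f s : path (@scoarser n) f s -> all (@idem n) s.
Proof. by elim: s f => //= g s IH f /andP[/andP[_ /and3P[_ -> _]] /IH]. Qed.

Lemma is_chain_enc s : all (@idem n) s -> is_chain (enc_chain s) = pchain s.
Proof.
move=> Is; have Ifs : all (@idem n) (fid n :: s) by rewrite /= idem_fid.
rewrite /is_chain /enc_chain /pchain all_rev all_map.
rewrite (eq_in_all (a2 := predT)) ?all_predT /=; last first.
  by move=> f fs; rewrite /= enc_pointed // (allP Ifs).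
have -> : sorted (@pp_lt n) (rev (enc (fid n) :: map enc s)) = path (@scoarser n) (fid n) s.
  rewrite rev_sorted -map_cons sorted_map.
  rewrite (eq_in_sorted (e' := @scoarser n) (P := @idem n)) //.
  by move=> f g If Ig /=; rewrite pp_lt_enc.
congr (_ && _); case/lastP: s Is {Ifs} => [|s f] Is.
  by rewrite /= pp_minimal_enc ?pp_maximal_enc ?idem_fid // eqxx andbT.
have /andP[If _] : idem f && all (@idem n) s by rewrite -all_rcons.
rewrite map_rcons -rcons_cons rev_rcons rev_cons last_rcons /= last_rcons.
by rewrite pp_minimal_enc // pp_maximal_enc ?idem_fid // eqxx andbT.
Qed.

Lemma pchain_idem s : pchain s -> all (@idem n) s.
Proof. by case/andP=> /path_scoarser_idem. Qed.

Lemma pchain_is_chain s : pchain s -> is_chain (enc_chain s).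
Proof. by move=> ps; rewrite is_chain_enc ?pchain_idem. Qed.

Definition dec_chain (g : seq (PP n)) : seq pmap := behead (map dec (rev g)).

Lemma enc_chainK s : all (@idem n) s -> dec_chain (enc_chain s) = s.
Proof.
move=> Is; rewrite /dec_chain /enc_chain revK /= -map_comp -[RHS]map_id.
by apply/eq_in_map => f fs /=; rewrite encK // (allP Is).
Qed.

Lemma is_chainP (g : seq (PP n)) : is_chain g -> exists2 s, pchain s & g = enc_chain s.
Proof.
move=> ch; have := ch; case/andP => /andP[pg _]; case/lastP: g pg ch => // g x.
rewrite all_rcons => /andP[px pg] ch px_max.
have mx : pp_maximal x.
  by case: g px_max {pg ch} => [|y g] /= /andP[_]; rewrite ?last_rcons.
have ex : x = enc (fid n).
  by move: mx; rewrite -{1}(decK px) pp_maximal_enc ?dec_idem // => /eqP <-; rewrite decK.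
have eg : rcons g x = enc_chain (map dec (rev g)).
  rewrite /enc_chain /= rev_cons -map_comp map_rev revK ex; congr rcons.
  rewrite -[LHS]map_id; apply/eq_in_map => y yg /=.
  by rewrite decK // (allP pg).
exists (map dec (rev g)) => //; rewrite -is_chain_enc -?eg //.
by rewrite all_map all_rev; apply: sub_all pg => y /dec_idem.
Qed.

Lemma pchain_delete s (i : nat) f : (i < size s)%N ->
  pchain (take i s ++ f :: drop i s) -> pchain s.
Proof.
move=> lis /andP[/(path_delete (@scoarser_trans n)) Hp]; rewrite last_insert // => Hr.
by rewrite /pchain Hp.
Qed.

Lemma enc_chain_insert s (i : nat) f : (i <= size s)%N ->
  enc_chain (take i s ++ f :: drop i s) =
  take (size s - i) (enc_chain s) ++ enc f :: drop (size s - i) (enc_chain s).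
Proof.
move=> lis; rewrite /enc_chain take_rev drop_rev size_map /= subSn ?leq_subr // subKn //=.
rewrite -map_take -map_drop map_cat /= -cat_cons rev_cat rev_cons cat_rcons.
by rewrite map_take map_drop.
Qed.

Lemma size_enc_chain s : size (enc_chain s) = (size s).+1.
Proof. by rewrite size_rev size_map. Qed.

Lemma pchain_size s : pchain s -> (size s <= n.-1)%N.
Proof.
case/andP=> Hp /eqP <-; rewrite -[X in (X <= _)%N]add0n -(rk_fid n).
elim: s (fid n) Hp => [|f s IH] g /=; first by rewrite addn0.
case/andP=> /rk_scoarser gf /IH; apply: leq_trans.
by rewrite addnS -addSn leq_add2r.
Qed.

(** Climbing from rank 0 to rank [n.-1] in [n.-1] strict steps makes every step a cover. *)
Lemma pchain_maxchain s : pchain s && (size s == n.-1) = maxchain s.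
Proof.
rewrite /pchain /maxchain; case: (size s =P n.-1) => [szs|]; rewrite ?andbF // !andbT.
have rks g u : path (covers (@scoarser n) (@rk n)) g u -> rk (last g u) = (rk g + size u)%N.
  elim: u g => [|f u IH] g /=; first by rewrite addn0.
  by case/andP => /andP[_ /eqP gf] /IH ->; rewrite gf addnS -addSn.
apply/andP/idP => [[Hp /eqP Hr]|Hp]; last first.
  rewrite (rks _ _ Hp) rk_fid szs eqxx; split=> //.
  by apply: sub_path Hp => f g /andP[].
have {szs Hr} : (rk (last (fid n) s) <= rk (fid n) + size s)%N by rewrite Hr rk_fid szs.
elim: s (fid n) Hp => //= f s IH g /andP[gf Hp] Hr.
have le_last h u : path (@scoarser n) h u -> (rk h + size u <= rk (last h u))%N.
  elim: u h => [|h' u IHu] h /=; first by rewrite addn0.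
  case/andP=> /rk_scoarser hh' /IHu; apply: leq_trans.
  by rewrite addnS -addSn leq_add2r.
have gf1 : rk f = (rk g).+1.
  apply/eqP; rewrite eqn_leq (rk_scoarser gf) andbT.
  by have := leq_trans (le_last _ _ Hp) Hr; rewrite addnS -addSn leq_add2r.
by rewrite /covers gf gf1 eqxx /= IH // gf1 addSnnS.
Qed.

End Encoding.

Lemma drop_at_insert (T : Type) (s : seq T) z i : (i <= size s)%N ->
  drop_at i (take i s ++ z :: drop i s) = s.
Proof.
move=> lis; have szi := size_takel lis.
rewrite /drop_at take_size_cat // -cat_rcons drop_size_cat ?size_rcons ?szi //.
exact: cat_take_drop.
Qed.

(** * Transport of the differential along the encoding *)

Section Transfer.
Variables (k : nzRingType) (n : nat).
Local Notation pmap := {ffun 'I_n -> 'I_n}.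
Implicit Types (s : seq pmap) (g : seq (PP n)) (e : seq pmap -> k).

(** Extension by zero to lists of any length, which avoids casts between tuple types when an element
    is inserted. *)
Definition coef m (c : {ffun m.-tuple (PP n) -> k}) g : k := oapp c 0 (insub g).

Definition pull m (c : {ffun m.-tuple (PP n) -> k}) s : k :=
  if pchain s then coef c (enc_chain s) else 0.

Definition push l e : Cspace k n l :=
  [ffun g : l.+1.-tuple (PP n) => if is_chain g then e (dec_chain g) else 0].

Lemma coef_tuple m (c : {ffun m.-tuple (PP n) -> k}) (t : m.-tuple (PP n)) : coef c t = c t.
Proof. by rewrite /coef valK. Qed.

Lemma coef_size m (c : {ffun m.-tuple (PP n) -> k}) g : coef c g != 0 -> size g = m.
Proof. by rewrite /coef; case: insubP => [t _ <- _|]; rewrite ?size_tuple ?eqxx. Qed.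

Lemma coef_supported l (c : Cspace k n l) g : supported c -> ~~ is_chain g -> coef c g = 0.
Proof. by rewrite /coef => sc; case: insubP => // t _ <- /sc. Qed.

Lemma supported_push l e : supported (push l e).
Proof. by move=> g /negbTE ng; rewrite ffunE ng. Qed.

Lemma pull_push l e s : pull (push l e) s = if pchain s && (size s == l) then e s else 0.
Proof.
rewrite /pull; case: ifP => //= ps.
rewrite /coef; case: insubP => [t|]; rewrite size_enc_chain eqSS.
  by move=> -> /= et; rewrite ffunE et pchain_is_chain // enc_chainK // pchain_idem.
by move/negbTE->.
Qed.

Lemma pull_supp l (c : Cspace k n l) s : pull c s != 0 -> pchain s && (size s == l).
Proof.
rewrite /pull; case: ifP => [_ /coef_size|_]; last by rewrite eqxx.
by rewrite size_enc_chain => -[->]; rewrite eqxx.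
Qed.

Lemma sum_insert m (c : {ffun m.+1.-tuple (PP n) -> k}) (t : m.-tuple (PP n)) i :
  (i <= m)%N -> \sum_(g : m.+1.-tuple (PP n)) c g *+ (val t == drop_at i g) =
  \sum_(z : PP n) coef c (take i t ++ z :: drop i t).
Proof.
move=> lim; have szt := size_tuple t.
have szins z : size (take i t ++ z :: drop i t) == m.+1.
  by rewrite size_cat /= addnS -size_cat cat_take_drop szt.
pose ins z := Tuple (szins z).
pose x0 := enc (fid n).
have dropE z : drop_at i (ins z) = t.
  by rewrite drop_at_insert // szt.
rewrite (bigID (fun g : m.+1.-tuple _ => val t == drop_at i g)) /= addrC big1 => [|g /negbTE ->//].
rewrite add0r (reindex_onto ins (fun g : m.+1.-tuple (PP n) => nth x0 g i)) /=.
  apply: eq_big => [z|z _]; last first.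
    by rewrite dropE eqxx -coef_tuple.
  rewrite dropE eqxx /= nth_cat size_take szt.
  have -> : (if (i < m)%N then i else m) = i by case: ltngtP lim.
  by rewrite ltnn subnn /= eqxx.
move=> g /eqP et; apply: val_inj => /=.
have ltig : (i < size g)%N by rewrite size_tuple ltnS.
rewrite et /drop_at take_size_cat ?drop_size_cat ?size_take ?ltig //.
by rewrite -drop_nth // cat_take_drop.
Qed.

Lemma sum_enc (F : PP n -> k) : (forall x, F x != 0 -> pointed_partition x) ->
  \sum_x F x = \sum_(f : pmap) if idem f then F (enc f) else 0.
Proof.
move=> HF; rewrite (bigID (@pointed_partition n)) /= [X in _ + X]big1 ?addr0; last first.
  by move=> x; apply: contraNeq => /HF.
rewrite (reindex_onto (@enc n) (@dec n)) => [|x]; last exact: decK.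
rewrite -big_mkcond /=; apply: eq_bigl => f; apply/andP/idP => [[pf /eqP <-]|If].
  exact: dec_idem.
by rewrite enc_pointed // encK.
Qed.

Lemma bdE l (c : Cspace k n l) (t : l.-tuple (PP n)) :
  bd c t = \sum_(i < l.+1 | (0 < i)%N && (i < l)%N)
     (-1) ^+ i * \sum_(z : PP n) coef c (take i t ++ z :: drop i t).
Proof.
rewrite ffunE exchange_big /=; apply: eq_bigr => i /andP[_ lil].
rewrite -sum_insert ?(ltnW lil) // mulr_sumr; apply: eq_bigr => g _.
by rewrite mulrnAr.
Qed.

(** Reversal turns insertion at [j] into insertion at [l - j], whence the global sign. *)
Lemma bd_pull l (c : Cspace k n l.+1) s (t : l.+1.-tuple (PP n)) : supported c ->
  pchain s -> size s = l -> val t = enc_chain s ->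
  bd c t = (-1) ^+ l * chain_bd (pull c) s.
Proof.
move=> sc ps szs et; rewrite bdE et chain_bd_expand szs mulr_sumr.
(* The extreme indices [0] and [l.+1] are excluded from the differential; the remaining [l] indices
   are then reversed. *)
rewrite big_mkcond big_ord_recl /= add0r big_ord_recr /= /bump leq0n add1n ltnn addr0.
rewrite (reindex_inj rev_ord_inj) /=; apply: eq_bigr => j _.
rewrite add1n subnSK // ltnS leq_subr.
rewrite mulrA -exprD -[in RHS]signr_odd oddD -oddB 1?ltnW // signr_odd; congr (_ * _).
rewrite sum_enc => [|x].
  apply: eq_bigr => f _; have Is := pchain_idem ps.
  have ljs : (j <= size s)%N by rewrite szs ltnW.
  have eins := enc_chain_insert f ljs; rewrite szs in eins.
  have Iins : all (@idem n) (take j s ++ f :: drop j s) = idem f.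
    by rewrite all_cat /= andbCA -all_cat cat_take_drop Is andbT.
  rewrite /pull -eins; case: ifP => [If|nIf]; last first.
    by case: ifP => // /pchain_idem; rewrite Iins nIf.
  rewrite -is_chain_enc ?Iins //.
  by case: ifP => // /negbT /(coef_supported sc).
apply: contraNT => npx; rewrite coef_supported //.
rewrite /is_chain all_cat /= (negbTE npx) /= !andbF //.
Qed.

(** Deleting an interior entry of a chain leaves a chain. *)
Lemma bd_not_chain l (c : Cspace k n l) (t : l.-tuple (PP n)) : supported c ->
  ~~ is_chain t -> bd c t = 0.
Proof.
move=> sc nt; rewrite bdE big1 // => i /andP[i0 il]; rewrite big1 ?mulr0 // => z _.
apply/eqP; apply: contraNT nt => /[dup] /coef_size sz nz.
have /is_chainP[u pu eu] : is_chain (take i t ++ z :: drop i t).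
  by apply: contraNT nz => /(coef_supported sc) ->.
have szu : size u = l.
  by have := congr1 size eu; rewrite sz size_enc_chain => -[].
have szt := size_tuple t.
have l1 : (0 < l.-1)%N by rewrite -ltnS (ltn_predK il) (leq_ltn_trans _ il).
have lil : (i <= l.-1)%N by rewrite -ltnS (ltn_predK il).
(* The encoded chain has [l.+1] entries and [u] omits the identity, so entry [i] from one end is
   entry [l.-1 - i] of [u]. *)
pose j := (l.-1 - i)%N.
pose s := take j u ++ drop j.+1 u.
have lj : (j < l.-1)%N by rewrite /j ltn_subrL i0.
have lju : (j < size u)%N by rewrite szu (leq_trans lj) ?leq_pred.
have eus : u = take j s ++ nth (fid n) u j :: drop j s.
  have szj : size (take j u) = j by rewrite size_take lju.
  rewrite /s take_size_cat // drop_size_cat // -drop_nth // cat_take_drop //.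
have szs : size s = l.-1.
  by have := congr1 size eus; rewrite size_insert szu => ->.
have ps : pchain s by apply: (@pchain_delete _ s j (nth (fid n) u j)); rewrite ?szs -?eus.
suff -> : t = enc_chain s :> seq _ by apply: pchain_is_chain.
have szes : size (enc_chain s) = l by rewrite size_enc_chain szs (ltn_predK il).
rewrite -(@drop_at_insert _ t z i) ?szt 1?ltnW // eu eus enc_chain_insert ?szs 1?ltnW //.
by rewrite /j subKn // drop_at_insert // szes ltnW.
Qed.

End Transfer.

(** * Homology *)

Section Homology.
Variables (k : comNzRingType) (n : nat).
Hypothesis n_gt0 : (0 < n)%N.
Local Notation pmap := {ffun 'I_n -> 'I_n}.
Local Notation word := (seq ('I_n * 'I_n)).
Implicit Types (s : seq pmap) (e : seq pmap -> k).

Lemma chain_bd_signed m e s : chain_bd (fun u => (-1) ^+ m * e u) s = (-1) ^+ m * chain_bd e s.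
Proof.
rewrite !chain_bd_expand mulr_sumr; apply: eq_bigr => i _.
by rewrite -mulr_sumr mulrCA.
Qed.

Lemma tuple_enc_chain m (t : m.+1.-tuple (PP n)) : is_chain t ->
  exists s, [/\ pchain s, size s = m & val t = enc_chain s].
Proof.
case/is_chainP => s ps et; exists s; split=> //.
by have := congr1 size et; rewrite size_tuple size_enc_chain => -[].
Qed.

Lemma pull_tuple m (c : {ffun m.-tuple (PP n) -> k}) (t : m.-tuple (PP n)) s :
  pchain s -> val t = enc_chain s -> pull c s = c t.
Proof. by move=> ps et; rewrite /pull ps -et coef_tuple. Qed.

Lemma cycle_chain_bd l (c : Cspace k n l) s : is_cycle c -> chain_bd (pull c) s = 0.
Proof.
case=> sc bc; apply/eqP; apply: contraT => nz.
have [i [f [lis /pull_supp/andP[pi /eqP szi]]]] := chain_bd_neq0 nz.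
have ps := pchain_delete lis pi; rewrite size_insert in szi; subst l.
have szt : size (enc_chain s) == (size s).+1 by rewrite size_enc_chain.
have := bd_pull (t := Tuple szt) sc ps erefl erefl; rewrite bc => /esym/eqP.
by rewrite -signr_odd mulr_sign; case: odd; rewrite ?oppr_eq0 (negbTE nz).
Qed.

Lemma chain_bd_cycle l (c : Cspace k n l) : supported c -> (forall s, chain_bd (pull c) s = 0) ->
  is_cycle c.
Proof.
move=> sc Dc; split=> // t.
have [/is_chainP[s ps et]|] := boolP (is_chain t); last exact: bd_not_chain.
have := size_tuple t; rewrite et size_enc_chain; case: l c t sc Dc et => // l c t sc Dc et [szs].
by rewrite (bd_pull sc ps szs et) Dc mulr0.
Qed.

Lemma boundary_chain_bd l (c : Cspace k n l) e : supported c ->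
  (forall s, e s != 0 -> pchain s && (size s == l.+1)) ->
  (forall s, chain_bd e s = pull c s) -> is_boundary c.
Proof.
(* The factor compensates for the global sign in [bd_pull]. *)
move=> sc He De; exists (push l.+1 (fun s => (-1) ^+ l * e s)).
split=> [|g]; first exact: supported_push.
have [/tuple_enc_chain[s [ps szs eg]]|ng] := boolP (is_chain g); last first.
  by rewrite bd_not_chain // ?sc //; apply: supported_push.
rewrite (bd_pull (supported_push _) ps szs eg) -(pull_tuple _ ps eg) -De.
rewrite (@eq_chain_bd _ _ (pull _) (fun s => (-1) ^+ l * e s)) => [|u].
  by rewrite chain_bd_signed signrMK.
rewrite pull_push; case: ifP => // nu; apply/esym/eqP.
apply: contraT => nz; have : e u != 0 by apply: contraNneq nz => ->; rewrite mulr0.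
by move/He; rewrite nu.
Qed.

Lemma boundary_pull0 l (c : Cspace k n l) : supported c -> (forall s, pull c s = 0) ->
  is_boundary c.
Proof.
move=> sc c0; apply: (@boundary_chain_bd l c (fun=> 0)) => // s; first by rewrite eqxx.
by rewrite chain_bd_0 c0.
Qed.

(** Above degree [n.-1] there are no chains. Below it, every chain from the identity starts above an
    atom, so [semimodular_acyclic] applies with the list of all atoms. *)
Theorem homology_vanishes_off_top l : l <> n.-1 -> homology_vanishes k n l.
Proof.
move=> ln c cc; have sc := cc.1.
have [ltl|gel] := ltnP l n.-1; last first.
  apply: boundary_pull0 => // s; apply/eqP; apply: contra_notT ln.
  move/pull_supp/andP => [ps /eqP sz]; apply/eqP; rewrite eqn_leq gel.
  by rewrite -sz pchain_size.
pose atoms := [seq a <- enum pmap | covers (@scoarser n) (@rk n) (fid n) a].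
have sm : forall x a a' z : pmap, a != a' ->
    covers (@scoarser n) (@rk n) x a -> covers (@scoarser n) (@rk n) x a' ->
    (a == z) || scoarser a z -> (a' == z) || scoarser a' z ->
    exists b, [/\ covers (@scoarser n) (@rk n) a b, scoarser a' b & (b == z) || scoarser b z].
  move=> x a a' z naa' xa xa'.
  rewrite !le_coarser ?(cov_idem xa).2 ?(cov_idem xa').2 // => az a'z.
  have [b [ab a'b bz]] := coarser_semimodular naa' xa xa' az a'z.
  by exists b; rewrite le_coarser ?(cov_idem ab).2.
have [||||e He De] := @semimodular_acyclic k _ (@scoarser n) (@rk n) n.-1
  (@scoarser_trans n) (@rk_scoarser n) sm (fid n) atoms l (pull c).
- by move=> a; rewrite mem_filter => /andP[].
- by rewrite rk_fid addn0.
- move=> s /pull_supp/andP[/andP[Hp Hr] szs]; rewrite /chain_from szs Hp Hr /=.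
  (* An empty chain would give [n.-1 = 0], against [l < n.-1]. *)
  case: s Hp Hr szs => [|f s] /=; first by rewrite rk_fid => _ /eqP e; rewrite -e in ltl.
  case/andP=> fs _ _ _; have [a xa af] := exists_cov fs; apply/hasP; exists a.
    by rewrite mem_filter xa mem_enum.
  by rewrite le_coarser // (cov_idem xa).2.
- by move=> s; apply: cycle_chain_bd.
apply: (boundary_chain_bd sc _ De) => s /He /andP[/and3P[szs Hp Hr] _].
by rewrite /pchain Hp Hr szs.
Qed.

(** The isomorphism: at a tree, the signed coefficient of the maximal chain traced by the word of
    that tree. *)
Definition prelie_of_chain (c : Cspace k n n.-1) (t : ptree n) : k :=
  tree_fun (word_fun (pull c)) t.

Lemma pull_maxchain (c : Cspace k n n.-1) s : pull c s != 0 -> maxchain s.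
Proof. by move/pull_supp; rewrite pchain_maxchain. Qed.

Lemma cycle_prelie_word (c : Cspace k n n.-1) : is_cycle c ->
  prelie_word_fun (word_fun (pull c)).
Proof.
move=> cc; apply: word_fun_prelie; first exact: pull_maxchain.
by apply: chain_bd_local_cycle => [|s]; [exact: pull_maxchain|exact: cycle_chain_bd].
Qed.

Lemma prelie_of_chainE (c : Cspace k n n.-1) t : multilinear t ->
  prelie_of_chain c t =
  (-1) ^+ list_sign [seq m.1 | m <- tmoves t] *
  coef c (enc_chain (wchain (fid n) (tmoves t))).
Proof.
move=> mt; have ct := complete_tmoves mt.
rewrite /prelie_of_chain /tree_fun mt /word_fun ct /pull.
by have := maxchain_wchain ct; rewrite -pchain_maxchain => /andP[->].
Qed.

(** A bounding element would be supported on chains of length greater than [n.-1], which ranks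
    forbid. *)
Lemma top_boundary0 (c : Cspace k n n.-1) : is_boundary c -> forall g, c g = 0.
Proof.
case=> y [sy ey] g; rewrite ey bdE big1 // => i _; rewrite big1 ?mulr0 // => z _.
apply/eqP; apply: contraT => /[dup] /coef_size sz nz.
have /is_chainP[s /pchain_size ps es] : is_chain (take i g ++ z :: drop i g).
  by apply: contraNT nz => /(coef_supported sy) ->.
by move: ps; have := congr1 size es; rewrite sz size_enc_chain => -[<-]; rewrite ltnn.
Qed.

Lemma word_fun_chain_fun (G : word -> k) w : complete w -> word_fun (chain_fun G) w = G w.
Proof.
move=> cw; rewrite /word_fun cw /chain_fun maxchain_wchain // wchainK ?signrMK //.
by case/andP: cw.
Qed.

(** The preimage evaluates [phi], up to sign, at the tree rebuilt from a maximal chain; rebuilding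
    from the word of a tree returns that tree. *)
Lemma prelie_of_chain_onto (phi : ptree n -> k) : in_prelie_dual phi ->
  exists2 c, is_cycle c & forall t, prelie_of_chain c t = phi t.
Proof.
move=> Hphi; pose r0 := Ordinal n_gt0.
have Hw := tree_word_prelie r0 Hphi; set G := tree_word phi r0 in Hw.
pose c := push n.-1 (chain_fun G).
have pc s : pull c s = chain_fun G s.
  rewrite pull_push pchain_maxchain; case: ifP => // ns.
  by rewrite /chain_fun ns.
exists c.
  apply: chain_bd_cycle => [|s]; first exact: supported_push.
  by rewrite (eq_chain_bd pc) local_cycle_chain_bd //; apply: chain_fun_local.
move=> t; rewrite /prelie_of_chain /tree_fun; case: ifP => [mt|/negbT/(proj1 Hphi) ->//].
rewrite -(tree_word_tmoves phi r0 mt) -/G -(word_fun_chain_fun G (complete_tmoves mt)).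
by rewrite /word_fun pc.
Qed.

(** Top boundaries vanish, so the point is injectivity: by [word_zero], values at tree words
    determine all coefficients of a cycle. *)
Lemma prelie_of_chain_ker (c : Cspace k n n.-1) : is_cycle c ->
  (forall t, prelie_of_chain c t = 0) <-> is_boundary c.
Proof.
move=> cc; split=> [f0|/top_boundary0 c0 t]; last first.
  rewrite /prelie_of_chain /tree_fun /word_fun /pull /coef.
  do 3?case: ifP => // _; rewrite ?mulr0 //; case: insub => [g|] /=; by rewrite ?c0 mulr0.
apply: boundary_pull0 => [|s]; first by case: cc.
apply/eqP; apply: contraT => nz; have ms := pull_maxchain nz.
have := ms => /andP[/path_cov_word[w vw ew] szs].
have cw : complete w by rewrite /complete vw -(size_wchain (fid n)) ew.
have := word_zero (cycle_prelie_word cc) w (Ordinal n_gt0).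
have Gt t : multilinear t -> word_fun (pull c) (tmoves t) = 0.
  by move=> mt; have := f0 t; rewrite /prelie_of_chain /tree_fun mt.
move/(_ Gt); rewrite /word_fun cw ew => /(congr1 ( *%R ((-1) ^+ list_sign [seq m.1 | m <- w]))).
by rewrite signrMK mulr0 => /eqP; rewrite (negbTE nz).
Qed.

(** * Equivariance under relabelling *)

Definition conj_map (sigma : 'S_n) (f : pmap) : pmap := [ffun i => sigma (f ((sigma^-1)%g i))].

Lemma enc_conj (sigma : 'S_n) f : enc (conj_map sigma f) = pp_act sigma (enc f).
Proof.
congr pair; last first.
  apply/setP => i; rewrite inE ffunE; apply/eqP/imsetP => [e|[j]].
    exists ((sigma^-1)%g i); rewrite ?permKV // inE -{2}e permK //.
  by rewrite inE => /eqP fj ->; rewrite permK fj.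
apply/setP => B; apply/enc_blockP/imsetP => [[i ->]|[A /enc_blockP[i ->] ->]].
  exists [set j | f ((sigma^-1)%g i) == f j]; first by apply/enc_blockP; exists ((sigma^-1)%g i).
  apply/setP => j; rewrite inE !ffunE (inj_eq perm_inj).
  apply/idP/imsetP => [e|[l]]; first by exists ((sigma^-1)%g j); rewrite ?permKV // inE.
  by rewrite inE => e ->; rewrite permK.
exists (sigma i); apply/setP => j; rewrite inE !ffunE (inj_eq perm_inj) permK.
apply/imsetP/idP => [[l]|e]; first by rewrite inE => e ->; rewrite permK.
by exists ((sigma^-1)%g j); rewrite ?permKV // inE.
Qed.

Lemma coef_act l (c : Cspace k n l) (sigma : 'S_n) g :
  coef (C_act sigma c) g = coef c (map (pp_act (sigma^-1)%g) g).
Proof.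
rewrite /coef; case: insubP => [t szg et|szg] /=; last by rewrite insubN // size_map.
rewrite ffunE -[in RHS]et; set t' := map_tuple _ t.
by rewrite -[map _ _]/(val t') valK.
Qed.

Lemma tmoves_relabel (sigma : 'S_n) t : tmoves (relabel sigma t) =
  [seq (sigma m.1, sigma m.2) | m <- tmoves t].
Proof.
have troot_relabel u : troot (relabel sigma u) = sigma (troot u) by elim: u.
by elim: t => //= a -> b ->; rewrite !map_cat /= !troot_relabel.
Qed.

Lemma leaves_relabel (sigma : 'S_n) t : leaves (relabel sigma t) = map sigma (leaves t).
Proof. by elim: t => //= a -> b ->; rewrite map_cat. Qed.

Lemma multilinear_relabel (sigma : 'S_n) t : multilinear (relabel sigma t) = multilinear t.
Proof.
have ml (tau : 'S_n) u : multilinear u -> multilinear (relabel tau u).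
  rewrite /multilinear leaves_relabel => mu.
  apply: uniq_perm => [||i]; rewrite ?enum_uniq //.
    by rewrite (map_inj_uniq perm_inj) (perm_uniq mu) enum_uniq.
  rewrite mem_enum; apply/mapP; exists ((tau^-1)%g i); rewrite ?permKV //.
  by rewrite (perm_mem mu) mem_enum.
apply/idP/idP; last exact: ml.
move/(ml (sigma^-1)%g); rewrite /multilinear !leaves_relabel -map_comp.
by rewrite (eq_map (g := id)) ?map_id // => i /=; rewrite permK.
Qed.

Lemma wchain_relabel (sigma : 'S_n) x (w : word) :
  wchain (conj_map sigma x) [seq (sigma m.1, sigma m.2) | m <- w] =
  map (conj_map sigma) (wchain x w).
Proof.
elim: w x => //= m w IH x.
have -> : absorb (sigma m.1) (sigma m.2) (conj_map sigma x) = conj_map sigma (absorb m.1 m.2 x).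
  by apply/ffunP => i; rewrite !ffunE (inj_eq perm_inj); case: ifP.
by rewrite IH.
Qed.

Lemma enc_chain_conj (sigma : 'S_n) s :
  map (pp_act sigma) (enc_chain s) = enc_chain (map (conj_map sigma) s).
Proof.
have conj_fid : conj_map sigma (fid n) = fid n by apply/ffunP => i; rewrite !ffunE permKV.
rewrite /enc_chain map_rev -{2}conj_fid -map_cons -!map_comp; congr rev.
by apply: eq_map => f; rewrite /= enc_conj.
Qed.

(** Relabelling a tree relabels the chain it traces, so the same coefficient is read on both sides;
    only the order of disappearance changes, by the inverse of [sigma], which has the same sign. *)
Lemma prelie_of_chain_act (sigma : 'S_n) (c : Cspace k n n.-1) t :
  prelie_of_chain (C_act sigma c) t =
  (-1) ^+ odd_perm sigma * dual_act sigma (prelie_of_chain c) t.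
Proof.
rewrite /dual_act; have [mt|nt] := boolP (multilinear t); last first.
  by rewrite /prelie_of_chain /tree_fun multilinear_relabel (negbTE nt) mulr0.
rewrite !prelie_of_chainE ?multilinear_relabel // coef_act enc_chain_conj.
set tau := (sigma^-1)%g.
have conj_fid : conj_map tau (fid n) = fid n by apply/ffunP => i; rewrite !ffunE permKV.
rewrite -wchain_relabel conj_fid -tmoves_relabel.
have [U S] := complete_uniq (complete_tmoves mt).
rewrite [in RHS]tmoves_relabel -map_comp /=.
have -> : [seq tau m.1 | m <- tmoves t] = map tau [seq m.1 | m <- tmoves t].
  by rewrite -map_comp.
rewrite list_sign_map // odd_permV signr_addb -!mulrA signrMK tmoves_relabel //.
Qed.

Theorem top_homology_prelie : homology_iso_prelie_sgn k n n.-1.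
Proof.
exists prelie_of_chain; split.
- move=> a x y _ _ t; rewrite /prelie_of_chain /tree_fun; case: ifP => _; last by rewrite mulr0 addr0.
  rewrite /word_fun; case: ifP => _; last by rewrite mulr0 addr0.
  rewrite mulrCA -mulrDr; congr (_ * _); rewrite /pull; case: ifP => _; last by rewrite mulr0 addr0.
  by rewrite /coef; case: insub => [g|] /=; rewrite ?ffunE ?mulr0 ?addr0.
- by move=> x /cycle_prelie_word; apply: tree_fun_prelie.
- exact: prelie_of_chain_onto.
- exact: prelie_of_chain_ker.
by move=> sigma x _ t; apply: prelie_of_chain_act.
Qed.

Theorem pointed_partition_homology_comNzRing : pointed_partition_homology k n.
Proof.
by move=> l; split=> [->|]; [exact: top_homology_prelie|exact: homology_vanishes_off_top].
Qed.

End Homology.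

Theorem mainTheorem5 (n : nat) (hn : (0 < n)%N) :
  [/\ pointed_partition_homology int n,
      pointed_partition_homology rat n,
      (forall p : nat, prime p -> pointed_partition_homology 'F_p n) &
      (forall F : fieldType, [pchar F] =i pred0 -> pointed_partition_homology F n)].
Proof. by split=> *; apply: pointed_partition_homology_comNzRing. Qed.
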